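(* Suppose $X=\mathbb{P}^2\times Y$ with $Y$ a smooth projective toric variety over $\mathbb{C}$, and let $\widetilde S[X]=\mathbb{C}[x_0,x_1,x_2,\,y_1,\dots,y_{m}]$, with the first three variables corresponding to $\mathbb{P}^2$ and the remaining variables corresponding to $Y$. Fix two monomials: $F=x_0^{(a_0)}x_1^{(a_1)}x_2^{(a_2)}$ with $a_0\ge a_1\ge a_2$, and $G\in\widetilde S[Y]=\mathbb{C}[y_1,\dots,y_{m}]$, such that $L=\deg(F\cdot G)\in\mathrm{Pic}(X)$ is very ample. Fix also a degree $D\in\mathrm{Pic}(Y)$ such that $\mathrm{Ann}(G)_D=0$. Then the $X$-border rank of $F\cdot G$ satisfies $$\mathrm{br}_X(F\cdot G)\ \ge\ (a_1+1)\cdot(a_2+1)\cdot\dim H^0(Y,D).$$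
   Context: For a smooth projective toric variety $Z$, the Cox ring $S[Z]=\bigoplus_{D\in\mathrm{Pic}(Z)}H^0(Z,D)=\mathbb{C}[\alpha_1,\dots,\alpha_N]$ is a $\mathrm{Pic}(Z)$-graded polynomial ring, with variables corresponding to the torus-invariant prime divisors (if $Z$ is a point, it is $\mathbb{C}$). $\widetilde S[Z]=\bigoplus_{D}H^0(Z,D)^*$ is the dual divided power algebra in dual variables $x_1,\dots,x_N$, $x_i^{(d)}=\frac1{d!}x_i^d$, on which $S[Z]$ acts by $$\alpha_i\lrcorner\big(x_1^{(c_1)}\cdots x_N^{(c_N)}\big)=x_1^{(c_1)}\cdots x_i^{(c_i-1)}\cdots x_N^{(c_N)}\text{ if }c_i>0,\text{ and }0\text{ otherwise.}$$ $\widetilde S[Z]_D=H^0(Z,D)^*$. For homogeneous $G\in\widetilde S[Z]$, $\mathrm{Ann}(G)=\{\Theta\in S[Z]\mid\Theta\lrcorner G=0\}$ and $\mathrm{Ann}(G)_D$ is its degree $D$ piece. For $X=\mathbb{P}^2\times Y$, $\mathrm{Pic}(X)=\mathbb{Z}\oplus\mathrm{Pic}(Y)$ and $\widetilde S[X]=\widetilde S[\mathbb{P}^2]\otimes\widetilde S[Y]$. $X$ is embedded in $\mathbb{P}(H^0(X,L)^* )=\mathbb{P}(\widetilde S[X]_L)$ by the complete linear system of $L$; the $X$-border rank of $H\in\widetilde S[X]_L$ is the least $r$ such that $[H]$ lies in the closure of the union of linear spans of $r$-tuples of points of $X$. *)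

(* Defs.v *)
From mathcomp Require Import all_boot all_order all_algebra.
From mathcomp Require Import boolp classical_sets reals complex mpoly.
Set Implicit Arguments.
Unset Strict Implicit.
Unset Printing Implicit Defensive.
Import Order.TTheory GRing.Theory Num.Theory.
Local Open Scope ring_scope.
Local Open Scope classical_set_scope.

(** Fans. A smooth fan is simplicial, so a cone is recorded as the set of the
    rays that generate it; row [i] of [rays] is the primitive generator of the
    [i]-th ray in the lattice N = Z^[ldim]. *)

Record fan := Fan {
  ldim : nat;
  nrays : nat;
  rays : 'M[int]_(nrays, ldim);
  cones : {set {set 'I_nrays}} }.

Definition in_cone (R : realType) (Y : fan) (s : {set 'I_(nrays Y)})
    (v : 'rV[R]_(ldim Y)) : Prop :=
  exists c : 'rV[R]_(nrays Y),
    [/\ forall i, 0 <= c 0 i,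
        forall i, i \notin s -> c 0 i = 0
      & v = c *m map_mx intr (rays Y)].

Definition is_fan (R : realType) (Y : fan) : Prop :=
  [/\ forall i, [set i]%SET \in cones Y,
      forall s t : {set 'I_(nrays Y)},
        s \in cones Y -> t \subset s -> t \in cones Y
    & forall s t : {set 'I_(nrays Y)}, s \in cones Y -> t \in cones Y ->
        forall v : 'rV[R]_(ldim Y),
          in_cone s v -> in_cone t v -> in_cone (s :&: t)%SET v].

(* The generators of every cone are part of a Z-basis of N. *)
Definition smooth_fan (Y : fan) : Prop :=
  forall s, s \in cones Y ->
  exists (B : 'M[int]_(ldim Y)) (f : 'I_(nrays Y) -> 'I_(ldim Y)),
    [/\ B \in unitmx, {in s &, injective f}
      & forall i, i \in s -> row i (rays Y) = row (f i) B].

Definition complete_fan (R : realType) (Y : fan) : Prop :=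
  forall v : 'rV[R]_(ldim Y), exists2 s, s \in cones Y & in_cone s v.

Definition fan_P2 : fan :=
  @Fan 2 3
    (\matrix_(i < 3, j < 2)
       (if i == 0 :> nat then -1 else (i == j.+1 :> nat)%:R))
    [set s | s != [set: 'I_3]]%SET.

Definition fan_prod (Y Z : fan) : fan :=
  @Fan (ldim Y + ldim Z) (nrays Y + nrays Z)
    (block_mx (rays Y) 0 0 (rays Z))
    [set s : {set 'I_(nrays Y + nrays Z)} | (@lshift (nrays Y) (nrays Z) @^-1: s \in cones Y)
           & (@rshift (nrays Y) (nrays Z) @^-1: s \in cones Z)]%SET.

(** The Picard group, as torus-invariant divisors modulo linear equivalence:
    [rays Y *m w] is the divisor of the character [w]. An element of Pic(Y) is
    given below by any divisor [D] representing it. *)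

Definition divisor (Y : fan) := 'cV[int]_(nrays Y).

Definition lin_equiv (Y : fan) (D E : divisor Y) : Prop :=
  exists w : 'cV[int]_(ldim Y), D - E = rays Y *m w.

(** The Cox ring S[Y] and its dual, both polynomial rings in one variable per
    ray and graded by Pic(Y). *)

Notation cox R Y := {mpoly (complex R)[nrays Y]}.
Notation dual_cox R Y := {mpoly (complex R)[nrays Y]}.

Definition mon_degree (Y : fan) (c : 'X_{1..nrays Y}) : divisor Y :=
  \col_i (c i)%:Z.

(* The degree [D] part: S[Y]_D = H^0(Y, D), or its dual in the dual ring. *)
Definition graded (R : realType) (Y : fan) (D : divisor Y) : set (cox R Y) :=
  [set f | forall c, c \in msupp f -> lin_equiv (mon_degree c) D].

Section Contraction.
Variables (K : fieldType) (N : nat).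
Implicit Types (T H : {mpoly K[N]}) (a c : 'X_{1..N}).

Definition divmon c : {mpoly K[N]} := (\prod_i (c i)`!)%:R^-1 *: 'X_[c].

(* In characteristic 0 the contraction action on divided powers is the action
   by differentiation: see [contractX_divmon] and [contractM]. *)
Definition contract T H : {mpoly K[N]} :=
  \sum_(a <- msupp T) T@_a *: H^`M[a].

(* The duality pairing of S_D with its dual. *)
Definition pairing T H : K := (contract T H)@_0%MM.

Definition Ann H : set {mpoly K[N]} := [set T | contract T H = 0].

Lemma contractX_mderiv i H : contract 'X_i H = H^`M(i).
Proof. by rewrite /contract msuppX big_seq1 mcoeffX eqxx scale1r mderivmU1m. Qed.

Lemma contractX_divmon i c : [pchar K] =i pred0 ->
  contract 'X_i (divmon c) =
  if (0 < c i)%N then divmon (c - U_(i))%MM else 0.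
Proof.
move=> K0; rewrite contractX_mderiv /divmon mderivZ mderivX.
case: posnP => [->|ci_gt0]; first by rewrite scale0r scaler0.
rewrite scalerA; congr (_ *: _).
have -> : (\prod_j (c j)`! = c i * \prod_j ((c - U_(i))%MM j)`!)%N.
  rewrite (bigD1 i) //= [in RHS](bigD1 i) //= mulnA mnmBE mnm1E eqxx subn1.
  congr (_ * _)%N; first by case: (c i) ci_gt0 => // k _; rewrite factS.
  by apply: eq_bigr => j ji; rewrite mnmBE mnm1E eq_sym (negPf ji) subn0.
have ci_neq0 : (c i)%:R != 0 :> K.
  by move/pcharf0P: K0 => ->; rewrite -lt0n.
by rewrite natrM invfM mulrAC mulVf // mul1r.
Qed.

Lemma contractE s T H : uniq s -> {subset msupp T <= s} ->
  contract T H = \sum_(a <- s) T@_a *: H^`M[a].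
Proof.
move=> s_uniq sTs; rewrite /contract [RHS](bigID (fun a => a \in msupp T)) /=.
rewrite [X in _ + X]big1 ?addr0 => [|a]; last first.
  by rewrite -mcoeff_eq0 => /eqP->; rewrite scale0r.
rewrite -[RHS]big_filter; apply: perm_big; apply: uniq_perm.
- exact: msupp_uniq.
- exact: filter_uniq.
by move=> a; rewrite mem_filter; case: (boolP (a \in msupp T)) => // /sTs.
Qed.

Lemma contract_lin x T T' H :
  contract (x *: T + T') H = x *: contract T H + contract T' H.
Proof.
set s := undup (msupp T ++ (msupp T' ++ msupp (x *: T + T'))).
rewrite !(@contractE s) ?undup_uniq //;
  try by move=> a; rewrite mem_undup !mem_cat => ->; rewrite ?orbT.
rewrite scaler_sumr -big_split; apply: eq_bigr => a _ /=.
by rewrite mcoeffD mcoeffZ scalerDl scalerA.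
Qed.

Lemma contractM T T' H : contract (T * T') H = contract T (contract T' H).
Proof.
have conX a H0 : contract 'X_[a] H0 = H0^`M[a].
  by rewrite /contract msuppX big_seq1 mcoeffX eqxx scale1r.
have con0 H0 : contract 0 H0 = 0 by rewrite /contract msupp0 big_nil.
have conD T1 T2 H0 : contract (T1 + T2) H0 = contract T1 H0 + contract T2 H0.
  by rewrite -[T1]scale1r contract_lin !scale1r.
have conZ x T1 H0 : contract (x *: T1) H0 = x *: contract T1 H0.
  by rewrite -[x *: T1]addr0 contract_lin con0 addr0.
elim/mpolyind: T => [|x a T _ _ IH]; first by rewrite mul0r !con0.
rewrite mulrDl !conD IH -scalerAl !conZ; congr (x *: _ + _).
rewrite conX; elim/mpolyind: T' {IH} => [|y a' T' _ _ IH].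
  by rewrite mulr0 !con0 (raddf0 (mderivm a)).
rewrite mulrDr !conD IH -scalerAr !conZ -mpolyXD !conX mderivmD mderivmZ.
by rewrite addmC mderivmDm.
Qed.

End Contraction.
Arguments divmon {K N} c.

(** Dimension of a finite-dimensional subspace (0 for the others). *)

Definition is_basis (K : fieldType) (V : lmodType K) (W : set V) (d : nat)
    (e : 'I_d -> V) : Prop :=
  [/\ forall i, W (e i),
      forall c : 'I_d -> K, \sum_i c i *: e i = 0 -> forall i, c i = 0
    & forall v, W v -> exists c : 'I_d -> K, v = \sum_i c i *: e i].

Definition subspace_dim (K : fieldType) (V : lmodType K) (W : set V) : nat :=
  xget 0%N [set d | exists e : 'I_d -> V, is_basis W e].

Section ToricVariety.
Variables (R : realType) (Y : fan).
Implicit Types (L : divisor Y) (p q : 'I_(nrays Y) -> complex R).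

(** Closed points in Cox (homogeneous) coordinates. The toric variety is the
    quotient of the complement of the zero locus of the irrelevant ideal by the
    torus Hom(Pic(Y), C^* ). *)

Definition is_point p : Prop :=
  exists2 s, s \in cones Y & forall i, i \notin s -> p i != 0.

Definition same_point p q : Prop :=
  exists t : 'I_(nrays Y) -> complex R,
    [/\ forall i, t i != 0,
        forall w : 'cV[int]_(ldim Y), \prod_i t i ^ (rays Y *m w) i 0 = 1
      & forall i, q i = t i * p i].

(** The projective space P(dual_L). Its points are represented by nonzero
    vectors of the dual of S_L, and its homogeneous coordinate ring is the
    symmetric algebra of S_L: a form on it is a homogeneous polynomial [P]
    evaluated at finitely many linear forms [T i] in S_L. *)

Definition proj_space L : set (dual_cox R Y) :=
  [set V | graded L V /\ V != 0].

Definition form_at k (T : 'I_k -> cox R Y) (P : {mpoly (complex R)[k]})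
    (V : dual_cox R Y) : complex R :=
  P.@[fun i => pairing (T i) V].

Definition zariski_closure L (A : set (dual_cox R Y)) : set (dual_cox R Y) :=
  [set V | proj_space L V /\
    forall k (T : 'I_k -> cox R Y) (P : {mpoly (complex R)[k]}) (d : nat),
      (forall i, graded L (T i)) -> P \is d.-homog ->
      (forall W, A W -> form_at T P W = 0) -> form_at T P V = 0].

(* [V] represents the image of [p] under the map given by the complete linear
   system of [L], that is, the line spanned by evaluation at [p]. *)
Definition lin_system L p (V : dual_cox R Y) : Prop :=
  proj_space L V /\ exists2 l : complex R, l != 0 &
    forall T : cox R Y, graded L T -> pairing T V = l * T.@[p].

Definition lin_system_image L (A : set ('I_(nrays Y) -> complex R)) :
    set (dual_cox R Y) :=
  [set V | exists2 p, is_point p /\ A p & lin_system L p V].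

(* The closed subset of the variety cut out by homogeneous elements [I]. *)
Definition zero_locus (I : set (cox R Y)) : set ('I_(nrays Y) -> complex R) :=
  [set p | forall f, I f -> f.@[p] = 0].

(* [L] is very ample when its complete linear system is everywhere defined and
   a closed immersion: injective, closed, and surjective on the stalks of the
   structure sheaves. The stalk of O_Y at [p] consists of the fractions f / g of
   homogeneous elements of the same degree with g(p) <> 0, and the form [P] on
   the projective space pulls back to the polynomial in the [T i]. *)
Definition very_ample L : Prop :=
  [/\ forall p, is_point p -> exists V, lin_system L p V,
      forall p q V, is_point p -> is_point q ->
        lin_system L p V -> lin_system L q V -> same_point p q,
      forall I : set (cox R Y),
        (forall f, I f -> exists E, graded E f) ->
        zariski_closure L (lin_system_image L (zero_locus I))
          `<=` lin_system_image L (zero_locus I)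
    & forall p (E : divisor Y) (f g : cox R Y),
        is_point p -> graded E f -> graded E g -> g.@[p] != 0 ->
        exists (k : nat) (T : k.-tuple (cox R Y))
          (A B : {mpoly (complex R)[k]}) (d : nat),
          [/\ forall i, graded L (tnth T i),
              A \is d.-homog, B \is d.-homog,
              (B \mPo T).@[p] != 0
            & f * (B \mPo T) = g * (A \mPo T)]].

Definition smooth_projective_toric : Prop :=
  [/\ is_fan R Y, smooth_fan Y, complete_fan R Y
    & exists L : divisor Y, very_ample L].

(* The union of the linear spans of [r]-tuples of points. *)
Definition spans L (r : nat) : set (dual_cox R Y) :=
  [set V | proj_space L V /\
    exists (p : 'I_r -> 'I_(nrays Y) -> complex R)
      (v : 'I_r -> dual_cox R Y) (l : 'I_r -> complex R),
      [/\ forall i, is_point (p i),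
          forall i, lin_system L (p i) (v i)
        & V = \sum_i l i *: v i]].

(* The least [r] such that [H] is in the closure of [spans L r]; the default
   value 0 is for the case where there is no such [r]. *)
Definition border_rank L (H : dual_cox R Y) : nat :=
  if pselect (exists r, `[< zariski_closure L (spans L r) H >]) is left ex
  then ex_minn ex else 0%N.

End ToricVariety.

(** The product of an element of the dual ring of Y with one of the dual ring of
    Z, in the dual ring of Y x Z. *)

Definition box_prod (R : realType) (Y Z : fan)
    (F : dual_cox R Y) (G : dual_cox R Z) : dual_cox R (fan_prod Y Z) :=
  (F \mPo [tuple 'X_(lshift (nrays Z) i) | i < nrays Y]) *
  (G \mPo [tuple 'X_(rshift (nrays Y) i) | i < nrays Z]).

(* Main.v *)
Require Import Defs.
From mathcomp Require Import all_boot all_order all_algebra.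
From mathcomp Require Import boolp classical_sets reals complex mpoly.
From mathcomp Require Import fraction zify.
Set Implicit Arguments.
Unset Strict Implicit.
Unset Printing Implicit Defensive.
Import Order.TTheory GRing.Theory Num.Theory.
Local Open Scope ring_scope.

(** Let [x^c0] be the monomial [F G], let [h] be the dimension of [H^0(Y, D)],
    and suppose that [x^c0] lies in the closure of the spans of [r] points. The
    proof is border apolarity with valuations in the place of the multigraded
    Hilbert scheme.

    The coordinates of the generic point of the [r]-th secant variety lie in a
    field [M] of rational functions: the functions of [r] generic points and [r]
    generic coefficients. That [x^c0] is in the closure means that some valuation
    ring of [M] specializes the generic point to [x^c0]; such a ring comes from
    Chevalley's theorem ([chevalley], [secant_closure_valuation]).

    Consider the forms of degree [(e, D)] over [M] that vanish at the [r] generic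
    points. Call a monomial leading for such a form if its coefficient dominates
    the others for the valuation, ties being broken by a monomial order. The set
    [J_e] of all leading monomials plays the part of the limit ideal:
    - it has as many elements as the space of forms has dimension, so its
      complement has as many as the rank of evaluation at the points, which is at
      most [r] ([card_leading_set]);
    - multiplication by a variable of P^2 carries [J_e] into [J_(e+1)];
    - no member of [J_e] divides [x^c0], because multiplying a form by the
      complementary monomial isolates its leading coefficient in the generic
      point ([leading_monomials_Ann]);
    - the rank of evaluation does not decrease with [e], as no generic point
      lies on the coordinate line [alpha_0 = 0] ([rank_point_matrix]).

    The rest is counting, in the degrees [d = a1 + a2] and [d + 1]. All monomials
    of degree [D] divide [G], since [Ann(G)_D = 0]; so a monomial of [J_d] has an
    exponent exceeding [a_l] at some [x_l]. Hence [J_d] splits into three corners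
    of the triangle of monomials, with sides [d - a_l], which stay disjoint in
    degree [d + 1]. A subset of a corner with side [s] is multiplied by at least
    [(s + 2) / s] when it is shifted by the three variables ([corner_growth]).
    The sides are at most [a2], [a2] and [a1], and adding up gives
      [(a2 + 2) |J_d| <= a2 |J_(d+1)| + h (a1 + 1) (a1 - a2)].
    Monotonicity of the rank gives [|J_(d+1)| <= |J_d| + h (d + 2)]. Together
    they bound the complement of [J_d] from below by [(a1 + 1) (a2 + 1) h].

    Finally the border rank must be attained by some [r]: the evaluations at
    finitely many points of the torus span the dual of [H^0(X, L)]
    ([graded_mnm_spans]). *)

(** * Chevalley's existence theorem for valuation rings *)

Section Valuations.
Variable M : fieldType.
Implicit Types (x y z : M) (S m O : set M) (p q : {poly M}).
Local Open Scope classical_set_scope.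

Definition nonunital_subring S : Prop :=
  [/\ S 0, forall x y, S x -> S y -> S (x - y)
    & forall x y, S x -> S y -> S (x * y)].

Definition valuation_subring O : Prop :=
  [/\ O 1, forall x y, O x -> O y -> O (x - y),
      forall x y, O x -> O y -> O (x * y) & forall x, O x \/ O x^-1].

(** In a valuation ring the non-units are the elements whose inverse is outside. *)
Definition max_ideal O : set M := [set x | x = 0 \/ ~ O x^-1].

(** A nonunital subring [m] which is maximal among those without [1] lies in the
    maximal ideal of a valuation ring, namely the ring of the elements that
    multiply [m] into itself. *)
Section MaximalNonunital.
Variable m : set M.
Hypothesis m_ring : nonunital_subring m.
Hypothesis m_not1 : ~ m 1.
Hypothesis m_max : forall S, nonunital_subring S -> ~ S 1 -> m `<=` S -> S `<=` m.

Let m0 : m 0. Proof. by case: m_ring. Qed.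
Let mB x y : m x -> m y -> m (x - y). Proof. by case: m_ring => _ + _; apply. Qed.
Let mM x y : m x -> m y -> m (x * y). Proof. by case: m_ring => _ _; apply. Qed.
Let mN x : m x -> m (- x). Proof. by rewrite -sub0r; apply: mB. Qed.
Let mD x y : m x -> m y -> m (x + y).
Proof. by move=> mx my; rewrite -[y]opprK; apply/mB/mN. Qed.

Let msum (I : Type) (s : seq I) (P : pred I) (F : I -> M) :
  (forall i, m (F i)) -> m (\sum_(i <- s | P i) F i).
Proof. by move=> mF; elim/big_rec: _ => // i x _; apply: mD. Qed.

Let stabilizer : set M := [set x | forall y, m y -> m (x * y)].

(** The values at [x] of the polynomials over [m] form a nonunital subring that
    contains [m]. If it misses [1], then it is [m], and [x] stabilizes [m]. *)
Let poly_relation x :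
  ~ stabilizer x -> exists q, (forall i, m q`_i) /\ q.[x] = 1.
Proof.
move=> nx; apply: contrapT => no; apply: nx => y my.
pose S : set M := [set z | exists q, (forall i, m q`_i) /\ q.[x] = z].
apply: (m_max (S := S)).
- split.
  + by exists 0; split=> [i|]; rewrite ?coef0 ?horner0.
  + move=> _ _ [p [mp <-]] [q [mq <-]]; exists (p - q).
    by split=> [i|]; rewrite ?coefB ?hornerE //; apply: mB.
  + move=> _ _ [p [mp <-]] [q [mq <-]]; exists (p * q).
    by split=> [i|]; rewrite ?coefM ?hornerM //; apply: msum => j; apply: mM.
- by move=> [q ?]; apply: no; exists q.
- move=> z mz; exists z%:P; split=> [i|]; rewrite ?hornerC //.
  by rewrite coefC; case: ifP.
exists (y *: 'X); split=> [i|]; last by rewrite hornerZ hornerX mulrC.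
by rewrite coefZ coefX; case: eqP => _; rewrite ?mulr1 ?mulr0.
Qed.

(** Otherwise [1] would be a polynomial in the inverse with coefficients in [m],
    and clearing denominators would put a power of [1 - x], hence [1], in [m]. *)
Let unit_1B x : m x -> stabilizer (1 - x)^-1.
Proof.
move=> mx; apply: contrapT => /poly_relation[q [mq]].
have nz : 1 - x != 0 by rewrite subr_eq0; apply/eqP => x1; apply: m_not1; rewrite x1.
have stab1B n y : m y -> m ((1 - x) ^+ n * y).
  elim: n => [|n IH] my; first by rewrite expr0 mul1r.
  rewrite exprS -mulrA mulrBl mul1r; apply: mB; first exact: IH.
  by apply: mM => //; apply: IH.
move=> q1.
have : m ((1 - x) ^+ size q).
  rewrite -[_ ^+ _]mulr1 -[X in _ * X]q1 horner_coef mulr_sumr; apply: msum => i.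
  rewrite mulrCA mulrC exprVn -expfB // .
  by apply: stab1B.
have Bm n : m (1 - (1 - x) ^+ n).
  elim: n => [|n IH]; first by rewrite expr0 subrr.
  rewrite exprS mulrBl mul1r opprB addrA addrAC; apply: mD => //.
  rewrite -[X in X * _]mulr1 -mulrA mulrC mul1r; exact: stab1B.
move=> /mD/(_ (Bm (size q))); rewrite addrC subrK; exact: m_not1.
Qed.

(** The two relations shorten each other, as in Euclid's algorithm: the relation
    for [x^-1] expresses the leading power of [x] in the longer relation through
    lower powers, without leaving [m]. *)
Let no_two_relations n x p q : (size p + size q <= n)%N ->
  (forall i, m p`_i) -> (forall i, m q`_i) -> p.[x] = 1 -> q.[x^-1] = 1 -> False.
Proof.
elim: n x p q => [|n IH] x p q.
  rewrite leqn0 addn_eq0 !size_poly_eq0 => /andP[/eqP-> _] _ _.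
  by rewrite horner0 => /esym/eqP; rewrite oner_eq0.
wlog sqp : x p q / (size q <= size p)%N => [wl|] sz mp mq p1 q1.
  case/orP: (leq_total (size q) (size p)) => s; first exact: (wl x p q).
  by apply: (wl x^-1 q p) => //; rewrite ?invrK // addnC.
have xn0 : x != 0.
  apply/eqP => x0; apply: m_not1; rewrite -p1 x0 horner_coef0; exact: mp.
have sp0 : (0 < size p)%N.
  rewrite lt0n size_poly_eq0; apply/eqP => p0.
  by move: p1; rewrite p0 horner0 => /esym/eqP; rewrite oner_eq0.
pose k := (size p).-1.
pose u := (1 - q`_0)^-1.
have nz : 1 - q`_0 != 0.
  by rewrite subr_eq0; apply/eqP => e; apply: m_not1; rewrite e.
(* [r] represents [x ^+ k] with degree less than [k] *)
pose r := \poly_(j < k) (u * q`_(k - j)).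
have rx : r.[x] = x ^+ k.
  have e : x ^+ k * q.[x^-1] = x ^+ k by rewrite q1 mulr1.
  apply: (mulfI nz); rewrite horner_poly [RHS]mulrBl mul1r -[X in _ = X - _]e.
  rewrite (@horner_coef_wide _ k.+1); last by rewrite prednK.
  rewrite big_ord_recl /= expr0 mulr1 mulrDr [q`_0 * x ^+ k]mulrC addrAC subrr add0r.
  rewrite !mulr_sumr (reindex_inj rev_ord_inj) /=; apply: eq_bigr => j _.
  rewrite -mulrA mulVKf // /bump add1n.
  by rewrite subKn // mulrCA exprVn expfB_cond // (negPf xn0) add0n.
pose p' := p - p`_k *: 'X^k + p`_k *: r.
apply: (IH x p' q) => //.
- rewrite -ltnS; apply: leq_trans sz; rewrite ltn_add2r.
  rewrite -(prednK sp0) ltnS; apply/leq_sizeP => j kj.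
  rewrite !coefD coefN !coefZ coefXn coef_poly ltnNge kj /= mulr0 addr0.
  case: (ltngtP k j) kj => // [lt|->] _; last by rewrite mulr1 subrr.
  by rewrite mulr0 subr0 nth_default // -(prednK sp0).
- move=> i; rewrite !coefD coefN !coefZ coefXn coef_poly; apply: mD.
    by apply: mB => //; case: eqP => _; rewrite ?mulr1 ?mulr0.
  case: ifP => _; rewrite ?mulr0 //; apply: mM => //; exact: unit_1B.
- by rewrite !hornerE rx subrK.
Qed.

Let stabilizer_val : valuation_subring stabilizer.
Proof.
split=> [y|x y sx sy z mz|x y sx sy z mz|x].
- by rewrite mul1r.
- by rewrite mulrBl; apply: mB; [apply: sx|apply: sy].
- by rewrite -mulrA; apply/sx/sy.
apply: contrapT => /not_orP[/poly_relation[p [mp p1]] /poly_relation[q [mq q1]]].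
exact: (@no_two_relations _ x p q).
Qed.

Lemma maximal_nonunital_val :
  exists O, valuation_subring O /\ m `<=` max_ideal O.
Proof.
exists stabilizer; split=> // x mx; have [x0|xn0] := eqVneq x 0; [by left|right].
by move=> /(_ x mx); rewrite mulVf.
Qed.
End MaximalNonunital.

(** Zorn's lemma applied to nonunital subrings, where no ideal has to be carried
    along: being a proper ideal of a larger ring amounts to missing [1]. *)
Theorem chevalley S : nonunital_subring S -> ~ S 1 ->
  exists O, valuation_subring O /\ S `<=` max_ideal O.
Proof.
move=> S_ring S_not1.
(* The empty chain is bounded because [S] is added to every member. *)
pose P A := nonunital_subring (A `|` S) /\ ~ (A `|` S) 1.
have [F FP F_total|A [[A_ring A_not1] A_max]] := @Zorn_bigcup _ P.
  have [[X0 FX0]|F0] := pselect (exists X, F X); last first.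
    have -> : (\bigcup_(X in F) X) = set0.
      by rewrite -subset0 => x [X FX _]; apply: F0; exists X.
    by rewrite /P set0U.
  have two x y : (\bigcup_(X in F) X `|` S) x -> (\bigcup_(X in F) X `|` S) y ->
      exists X, [/\ F X, (X `|` S) x & (X `|` S) y].
    move=> [[X FX Xx]|Sx] [[Z FZ Zy]|Sy].
    - by case: (F_total X Z FX FZ) => XZ; [exists Z|exists X];
        split=> //; left => //; apply: XZ.
    - by exists X; split=> //; [left|right].
    - by exists Z; split=> //; [right|left].
    - by exists X0; split=> //; right.
  have up X x : F X -> (X `|` S) x -> (\bigcup_(X in F) X `|` S) x.
    by move=> FX [Xx|Sx]; [left; exists X|right].
  split.
    split=> [|x y Ux Uy|x y Ux Uy]; first by right; case: S_ring.
    - have [X [FX Xx Xy]] := two x y Ux Uy; apply: (up X) => //.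
      by have [[_ + _] _] := FP X FX; apply.
    - have [X [FX Xx Xy]] := two x y Ux Uy; apply: (up X) => //.
      by have [[_ _ +] _] := FP X FX; apply.
  by move=> U1; have [X [FX X1 _]] := two _ _ U1 U1; have [_] := FP X FX.
have [|O [O_val AO]] := @maximal_nonunital_val (A `|` S) A_ring A_not1.
  move=> B B_ring B_not1 AB; apply: contrapT => BA; apply: (A_max B).
    split; last by move=> Ax; apply: BA => x Bx; left; apply: Ax.
    by move=> x Ax; apply: AB; left.
  suff -> : P B = (nonunital_subring B /\ ~ B 1) by [].
  by rewrite /P (_ : B `|` S = B) //; apply/setUidPl => x Sx; apply: AB; right.
by exists O; split=> // x Sx; apply: AO; right.
Qed.

End Valuations.

(** * Leading terms of relations over a valued field *)

Section LeadingTerms.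
Variables (M : fieldType) (O : set M).
Hypothesis O_val : valuation_subring O.
Implicit Types (x y z : M).
Local Notation mO := (max_ideal O).

Lemma val1 : O 1. Proof. by case: O_val. Qed.
Lemma val0 : O 0. Proof. by rewrite -(subrr 1); case: O_val => O1 OB _ _; apply: OB. Qed.
Lemma valM x y : O x -> O y -> O (x * y). Proof. by case: O_val => _ _ + _; apply. Qed.
Lemma valD x y : O x -> O y -> O (x + y).
Proof.
move=> Ox Oy; case: (O_val) => _ OB _ _; rewrite -[y]opprK; apply: (OB) => //.
by rewrite -sub0r; apply: OB => //; apply: val0.
Qed.

Lemma max_ideal_val x : mO x -> O x.
Proof.
by case=> [->|nx]; [apply: val0|case: O_val => _ _ _ /(_ x)[]].
Qed.

Lemma val_total x : O x \/ mO x^-1.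
Proof. by have [Ox|nx] := pselect (O x); [left|right; right; rewrite invrK]. Qed.

Lemma max_ideal0 : mO 0. Proof. by left. Qed.

Lemma max_ideal_not1 : ~ mO 1.
Proof. by case=> [/eqP|]; rewrite ?oner_eq0 // invr1 => /(_ val1). Qed.

Lemma max_idealMl x y : O x -> mO y -> mO (x * y).
Proof.
move=> Ox [->|ny]; first by rewrite mulr0; left.
have [->|x0] := eqVneq x 0; first by rewrite mul0r; left.
right; apply: contra_not ny => Oxy.
by rewrite -[y^-1](mulVKf x0) -invfM; apply: valM.
Qed.

Lemma max_idealD x y : mO x -> mO y -> mO (x + y).
Proof.
wlog Oxy : x y / O (x / y) => [wl mx my|mx my].
  have [|/max_ideal_val] := val_total (x / y); first by move=> ?; apply: wl.
  by rewrite invf_div addrC => ?; apply: wl.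
have [y0|y0] := eqVneq y 0; first by rewrite y0 addr0.
rewrite -[x](divfK y0) -{3}[y]mul1r -mulrDl; apply: max_idealMl => //.
by apply: valD => //; apply: val1.
Qed.

Lemma max_idealN x : mO x -> mO (- x).
Proof.
move=> mx; rewrite -mulN1r; apply: max_idealMl => //.
by case: (O_val) => O1 OB _ _; rewrite -sub0r; apply: OB => //; apply: val0.
Qed.

Lemma max_ideal_sum (I : Type) (s : seq I) (P : pred I) (F : I -> M) :
  (forall i, P i -> mO (F i)) -> mO (\sum_(i <- s | P i) F i).
Proof.
move=> mF; elim/big_rec: _ => [|i x Pi]; first exact: max_ideal0.
by apply: max_idealD; apply: mF.
Qed.

Variables (d : Order.disp_t) (T : orderType d).

(** Coefficients are compared by valuation; on a tie the larger key wins. *)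
Definition below (I : finType) (key : I -> T) (f : I -> M) (j i : I) : Prop :=
  O (f j / f i) /\ ((key i < key j)%O -> mO (f j / f i)).

Definition leading (I : finType) (key : I -> T) (f : I -> M) (i : I) : Prop :=
  f i != 0 /\ forall j, below key f j i.

Lemma leading_exists (I : finType) (key : I -> T) (f : I -> M) j :
  f j != 0 -> exists i, leading key f i.
Proof.
move=> fj.
have below_refl i : f i != 0 -> below key f i i.
  by move=> fi; split; rewrite ?divff ?ltxx //; apply: val1.
have below_trans k i l : f i != 0 -> below key f k i -> below key f i l -> below key f k l.
  move=> fi [Oki mki] [Oil mil]; rewrite /below.
  have -> : f k / f l = (f k / f i) * (f i / f l) by rewrite mulrA divfK.
  split=> [|lk]; first exact: valM.
  have [il|li] := ltP (key l) (key i); first exact: (max_idealMl Oki (mil il)).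
  by rewrite mulrC; apply: (max_idealMl Oil); apply: mki; apply: le_lt_trans lk.
have below_total i l : below key f i l \/ below key f l i.
  rewrite /below; have e : (f i / f l)^-1 = f l / f i by rewrite invf_div.
  have [Oil|] := val_total (f i / f l); last first.
    by rewrite e => mli; right; split=> //; apply: max_ideal_val.
  have := val_total (f l / f i); rewrite invf_div => -[Oli|mil]; last by left.
  have [li|il] := ltP (key l) (key i); last by left; split.
  by right; split=> // /(lt_trans li); rewrite ltxx.
have [i [fi _ lead_i]] : exists i,
    [/\ f i != 0, i \in enum I & forall k, k \in enum I -> below key f k i].
  have : has (fun k => f k != 0) (enum I) by apply/hasP; exists j; rewrite ?mem_enum.
  elim: (enum I) => //= k s IH; have [fk _|] := boolP (f k != 0).
    have [/IH[i [fi is_ lead_i]]|s0] := boolP (has (fun k => f k != 0) s).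
      have [ki|ik] := below_total k i.
        exists i; split; rewrite ?inE ?is_ ?orbT // => l; rewrite inE.
        by case/orP=> [/eqP->//|/lead_i].
      exists k; split; rewrite ?inE ?eqxx // => l; rewrite inE.
      case/orP=> [/eqP->|/lead_i li]; first exact: below_refl.
      exact: below_trans li ik.
    exists k; split; rewrite ?inE ?eqxx // => l; rewrite inE.
    case/orP=> [/eqP->|ls]; first exact: below_refl.
    move/hasPn: s0 => /(_ l ls); rewrite negbK => /eqP l0.
    by split=> [|_]; rewrite l0 mul0r; [apply: val0|apply: max_ideal0].
  rewrite negbK /= => /eqP k0 /IH[i [fi is_ lead_i]].
  exists i; split; rewrite ?inE ?is_ ?orbT // => l; rewrite inE.
  case/orP=> [/eqP->|/lead_i//].
  by split=> [|_]; rewrite k0 mul0r; [apply: val0|apply: max_ideal0].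
by exists i; split=> // k; apply: lead_i; rewrite mem_enum.
Qed.

Section Kernel.
Variables (n r : nat) (key : 'I_n -> T) (W : 'M[M]_(n, r)).
Hypothesis key_inj : injective key.

Definition leading_set : {set 'I_n} :=
  [set i | `[< exists f : 'rV_n, f *m W = 0 /\ leading key (f 0) i >]].

Lemma leading_setP i :
  i \in leading_set -> exists f : 'rV_n, f *m W = 0 /\ leading key (f 0) i.
Proof. by rewrite inE => /asboolP. Qed.

(** Relations normalized at distinct leading indices are independent: in a
    combination of them, the coefficient at the leading index of the combining
    vector cannot cancel. *)
Lemma leading_set_le : (#|leading_set| + \rank W <= n)%N.
Proof.
pose J := leading_set.
have ex_rel (i : 'I_#|J|) :
    exists f : 'rV_n, f *m W = 0 /\ leading key (f 0) (enum_val i).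
  by apply: leading_setP; apply: enum_valP.
have [f fP] := choice ex_rel.
pose F : 'M_(#|J|, n) := \matrix_(i, j) (f i 0 j / f i 0 (enum_val i)).
have F_free : row_free F.
  apply: inj_row_free => a aF; apply/eqP; apply: contraT => /rV0Pn[j aj].
  have [i [ai lead_i]] := @leading_exists _ (fun i => key (enum_val i)) (a 0) j aj.
  have {aF} : (a *m F) 0 (enum_val i) = 0 by rewrite aF mxE.
  rewrite mxE (bigD1 i) //= mxE divff ?mulr1; last by case: (fP i) => _ [].
  move/eqP; rewrite addr_eq0 => /eqP e.
  case: max_ideal_not1; rewrite -(divff ai) {1}e mulNr.
  apply: max_idealN; rewrite mulr_suml; apply: max_ideal_sum => k ki.
  rewrite mxE mulrAC; have [Oki mki] := lead_i k.
  have [_ [fk lead_k]] := fP k; have [Ok mk] := lead_k (enum_val i).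
  have [ik|] := ltP (key (enum_val i)) (key (enum_val k)).
    by rewrite mulrC; apply: max_idealMl; last apply: mki.
  rewrite le_eqVlt => /orP[/eqP/key_inj/enum_val_inj eki|ik].
    by rewrite eki eqxx in ki.
  by apply: max_idealMl; last apply: mk.
have FW : F *m W = 0.
  apply/row_matrixP => i; rewrite row_mul row0.
  have -> : row i F = (f i 0 (enum_val i))^-1 *: f i.
    by apply/rowP => j; rewrite !mxE mulrC.
  by rewrite -scalemxAl (fP i).1 scaler0.
by have := mulmx0_rank_max FW; rewrite (eqP F_free).
Qed.

(** A relation supported away from the leading indices vanishes, so the rows of
    [W] at those places are independent. *)
Lemma leading_set_ge : (n <= #|leading_set| + \rank W)%N.
Proof.
pose J := leading_set.
pose V := rowsub (fun i : 'I_#|~: J| => enum_val i) W.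
have V_free : row_free V.
  apply: inj_row_free => a aV; apply/eqP; apply: contraT => /rV0Pn[j aj].
  pose f := a *m rowsub (fun i : 'I_#|~: J| => enum_val i) 1%:M.
  have fE i : f 0 i = \sum_(k < #|~: J|) a 0 k * (enum_val k == i)%:R.
    by rewrite mxE; apply: eq_bigr => k _; rewrite !mxE.
  have fJ i : i \in J -> f 0 i = 0.
    move=> iJ; rewrite fE big1 // => k _; case: eqP => [e|]; rewrite ?mulr0 //.
    by have := enum_valP k; rewrite e inE iJ.
  have fj : f 0 (enum_val j) != 0.
    rewrite fE (bigD1 j) //= eqxx mulr1 big1 ?addr0 // => k kj.
    by rewrite (inj_eq enum_val_inj) (negPf kj) mulr0.
  have [i lead_i] := @leading_exists _ key (f 0) _ fj.
  have : i \in J by rewrite inE; apply/asboolP; exists f; rewrite -mulmxA -rowsubE.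
  by move/fJ/eqP; rewrite (negPf lead_i.1).
have : (\rank V <= \rank W)%N by apply/mxrankS/rowsub_sub.
rewrite (eqP V_free) -(leq_add2l #|J|) => /(leq_trans _); apply.
by rewrite cardsC card_ord.
Qed.

Lemma card_leading_set : (#|leading_set| + \rank W)%N = n.
Proof. by apply/eqP; rewrite eqn_leq leading_set_le leading_set_ge. Qed.
End Kernel.

(** This makes leading monomials stable under multiplication by a variable, with
    [phi] the multiplication: a relation is extended by [0] outside the image. *)
Lemma leading_set_shift n n' r (key : 'I_n -> T) (key' : 'I_n' -> T)
    (W : 'M[M]_(n, r)) (W' : 'M_(n', r)) (phi : 'I_n -> 'I_n') (D : 'M_r) :
  injective key ->
  {mono phi : i j / (key i < key j)%O >-> (key' i < key' j)%O} ->
  rowsub phi W' = W *m D ->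
  forall i, i \in leading_set key W -> phi i \in leading_set key' W'.
Proof.
move=> key_inj phi_mono eW i /leading_setP[f [fW [fi lead_i]]].
have phi_inj : injective phi.
  move=> k l e; apply: key_inj; apply/eqP; rewrite eq_le !leNgt.
  by rewrite -!phi_mono e ltxx.
pose f' := f *m rowsub phi 1%:M.
have f'E k : f' 0 k = \sum_l f 0 l * (phi l == k)%:R.
  by rewrite mxE; apply: eq_bigr => l _; rewrite !mxE.
have f'phi k : f' 0 (phi k) = f 0 k.
  rewrite f'E (bigD1 k) //= eqxx mulr1 big1 ?addr0 // => l lk.
  by rewrite (inj_eq phi_inj) (negPf lk) mulr0.
rewrite inE; apply/asboolP; exists f'; split.
  by rewrite -mulmxA -rowsubE eW mulmxA fW mul0mx.
rewrite /leading f'phi; split=> // k; rewrite /below f'phi.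
have [/existsP[l /eqP <-]|] := boolP [exists l, phi l == k].
  by rewrite f'phi phi_mono; apply: lead_i.
rewrite negb_exists => /forallP nk.
have -> : f' 0 k = 0.
  by rewrite f'E big1 // => l _; rewrite (negPf (nk l)) mulr0.
by rewrite mul0r; split=> [|_]; [apply: val0|apply: max_ideal0].
Qed.
End LeadingTerms.

(** * Growth of sets of monomials in the corners of a triangle *)

Section Corners.
Local Open Scope nat_scope.

Lemma leq_sum_sub (I : eqType) (s1 s2 : seq I) (F : I -> nat) :
  uniq s1 -> uniq s2 -> {subset s1 <= s2} ->
  \sum_(i <- s1) F i <= \sum_(i <- s2) F i.
Proof.
move=> u1 u2 s12; rewrite [leqRHS](bigID (mem s1)) /= -[X in _ <= X + _]big_filter.
rewrite (perm_big (filter (mem s1) s2)) /= ?leq_addr //.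
apply: uniq_perm => //; first exact: filter_uniq.
by move=> i; rewrite mem_filter /=; case: (boolP (i \in s1)) => // /s12.
Qed.

Definition monomials3 (e : nat) : seq 'X_{1..3} :=
  [seq [multinom [tuple e - j - k; j; k]] | j <- iota 0 e.+1, k <- iota 0 (e - j).+1].

Lemma mdeg3 (t : 'X_{1..3}) :
  mdeg t = t ord0 + t (lift ord0 ord0) + t (lift ord0 (lift ord0 ord0)).
Proof. by rewrite mdegE !big_ord_recl big_ord0 addn0 addnA. Qed.

Lemma mem_monomials3 e t : (t \in monomials3 e) = (mdeg t == e).
Proof.
apply/allpairsPdep/eqP => [[j [k [+ + ->]]]|te].
  by rewrite !mem_iota mdeg3 !mnm_tnth /tnth /=; lia.
rewrite mdeg3 in te.
exists (t (lift ord0 ord0)), (t (lift ord0 (lift ord0 ord0))); rewrite !mem_iota.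
split; [lia|lia|].
apply/mnmP => i; rewrite [RHS]mnm_tnth (tnth_nth 0); case: i => [[|[|[|i]]] // lt3] /=.
- by rewrite (_ : Ordinal lt3 = ord0); [lia|exact: val_inj].
- by congr (t _); exact: val_inj.
- by congr (t _); exact: val_inj.
Qed.

Lemma monomials3_uniq e : uniq (monomials3 e).
Proof.
apply: allpairs_uniq_dep => [|j _|]; rewrite ?iota_uniq //.
move=> [j k] [j' k'] _ _ /= [_ -> ->] //.
Qed.

Lemma size_monomials3 e : 2 * size (monomials3 e) = e.+1 * e.+2.
Proof.
rewrite size_allpairs_dep sumnE big_map.
rewrite (eq_bigr (fun j => (e - j).+1)) => [|j _]; last by rewrite size_iota.
rewrite -[iota _ _]/(index_iota 0 e.+1) big_nat_rev /= big_mkord add0n.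
rewrite (eq_bigr (fun j : 'I_e.+1 => j.+1)) => [|j _]; last by have := ltn_ord j; lia.
elim: e => [|e IH]; first by rewrite big_ord1.
by rewrite big_ord_recr /= mulnDr IH; lia.
Qed.

Section Monomials.
Variable n : nat.
Implicit Types (C : seq 'X_{1..n}) (m : 'X_{1..3 + n}) (J : seq 'X_{1..3 + n}).

Definition mnm_join (t : 'X_{1..3}) (c : 'X_{1..n}) : 'X_{1..3 + n} :=
  Multinom [tuple of val t ++ val c].
Definition mnm_left m : 'X_{1..3} := [multinom m (lshift n i) | i < 3].
Definition mnm_right m : 'X_{1..n} := [multinom m (rshift 3 i) | i < n].

Lemma mnm_join_l t c i : mnm_join t c (lshift n i) = t i.
Proof. by rewrite mnm_tnth tnth_lshift -mnm_tnth. Qed.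

Lemma mnm_join_r t c i : mnm_join t c (rshift 3 i) = c i.
Proof. by rewrite mnm_tnth tnth_rshift -mnm_tnth. Qed.

Lemma mnm_left_join t c : mnm_left (mnm_join t c) = t.
Proof. by apply/mnmP => i; rewrite mnmE mnm_join_l. Qed.

Lemma mnm_right_join t c : mnm_right (mnm_join t c) = c.
Proof. by apply/mnmP => i; rewrite mnmE mnm_join_r. Qed.

Lemma mnm_joinK m : mnm_join (mnm_left m) (mnm_right m) = m.
Proof.
apply/mnmP => i; rewrite -(splitK i); case: (split i) => j /=.
  by rewrite mnm_join_l mnmE.
by rewrite mnm_join_r mnmE.
Qed.

Definition monomials C e : seq 'X_{1..3 + n} :=
  [seq mnm_join t c | t <- monomials3 e, c <- C].

Lemma mem_monomials C e m :
  (m \in monomials C e) = (mdeg (mnm_left m) == e) && (mnm_right m \in C).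
Proof.
apply/allpairsP/andP => [[[t c] [/= te cC ->]]|[me mC]].
  by rewrite mnm_left_join mnm_right_join -mem_monomials3.
by exists (mnm_left m, mnm_right m); rewrite mem_monomials3 mnm_joinK.
Qed.

Lemma monomials_uniq C e : uniq C -> uniq (monomials C e).
Proof.
move=> uC; apply: allpairs_uniq => //; first exact: monomials3_uniq.
move=> [t c] [t' c'] _ _ /= E.
by rewrite -(mnm_left_join t c) E mnm_left_join -(mnm_right_join t c) E mnm_right_join.
Qed.

Lemma size_monomials C e : 2 * size (monomials C e) = size C * (e.+1 * e.+2).
Proof. by rewrite size_allpairs mulnA size_monomials3 mulnC. Qed.

Local Notation U l := U_(lshift n l)%MM.

Lemma mnm_left_addU m l : mnm_left (m + U l) = (mnm_left m + U_(l))%MM.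
Proof. by apply/mnmP => i; rewrite !mnmE eq_lshift. Qed.

Lemma mnm_right_addU m l : mnm_right (m + U l) = mnm_right m.
Proof. by apply/mnmP => i; rewrite !mnmE eq_lrshift addn0. Qed.

Lemma monomials_addU C e m l : m \in monomials C e -> (m + U l)%MM \in monomials C e.+1.
Proof.
by rewrite !mem_monomials mnm_left_addU mnm_right_addU mdegD mdeg1 addn1.
Qed.

Lemma mnm_left_le m l : m (lshift n l) <= mdeg (mnm_left m).
Proof. by rewrite mdegE (bigD1 l) //= mnmE leq_addr. Qed.

(** Double counting. Measure exponents from the vertex of the corner, that is, with
    [t] subtracted at the variable [l]. Shifting a monomial of [J] by the variable
    [i] adds one to its exponent at [i], so the sum over [J] of these exponents
    plus one is at most the sum over [J'] of the exponents at [i]. The inequality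
    results from summing over [i], as all monomials of [J] have the same degree,
    and those of [J'] too. *)
Lemma corner_growth C e t l J J' :
  uniq J -> uniq J' ->
  {subset J <= monomials C e} -> {subset J' <= monomials C e.+1} ->
  (forall m, m \in J -> t <= m (lshift n l)) ->
  (forall m, m \in J' -> t <= m (lshift n l)) ->
  (forall m i, m \in J -> (m + U i)%MM \in J') ->
  (e + 3 - t) * size J <= (e + 1 - t) * size J'.
Proof.
move=> uJ uJ' Je Je' Jt Jt' JJ'.
pose w (i : 'I_3) m := m (lshift n i) - (if i == l then t else 0).
have sum_w m : t <= m (lshift n l) -> \sum_i w i m = mdeg (mnm_left m) - t.
  move=> tm; rewrite mdegE (bigD1 l) //= [in RHS](bigD1 l) //= /w eqxx mnmE.
  rewrite [X in _ = _ + X - _](eq_bigr (fun i => m (lshift n i))); last first.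
    by move=> i _; rewrite mnmE.
  rewrite [X in _ + X = _](eq_bigr (fun i => m (lshift n i))); first lia.
  by move=> i /negPf ->; rewrite subn0.
have step i : \sum_(m <- J) (w i m).+1 <= \sum_(m <- J') w i m.
  rewrite (_ : \sum_(m <- J) _ = \sum_(m <- [seq (m + U i)%MM | m <- J]) w i m).
    apply: leq_sum_sub => //; first by rewrite map_inj_uniq //; apply: addIm.
    by move=> _ /mapP[m mJ ->]; apply: JJ'.
  rewrite big_map big_seq [RHS]big_seq; apply: eq_bigr => m mJ.
  rewrite /w mnmDE mnm1E eqxx; have := Jt m mJ.
  by case: eqP => [->|_]; lia.
have -> : (e + 3 - t) * size J = \sum_i \sum_(m <- J) (w i m).+1.
  rewrite exchange_big /= (eq_big_seq (fun=> e + 3 - t)) => [|m mJ].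
    by rewrite big_const_seq count_predT iter_addn_0.
  have tm := Jt m mJ; have := mnm_left_le m l.
  move: (Je m mJ); rewrite mem_monomials => /andP[/eqP me _].
  under eq_bigr do rewrite -addn1; rewrite big_split /= sum_w // sum1_card card_ord me.
  by lia.
have -> : (e + 1 - t) * size J' = \sum_i \sum_(m <- J') w i m.
  rewrite exchange_big /= (eq_big_seq (fun=> e + 1 - t)) => [|m mJ].
    by rewrite big_const_seq count_predT iter_addn_0.
  move: (Je' m mJ); rewrite mem_monomials => /andP[/eqP me _].
  by rewrite sum_w ?Jt' // me addn1.
by apply: leq_sum => i _; apply: step.
Qed.

(** Dividing by the [t]-th power of the variable maps the corner into a triangle
    of monomials. *)
Lemma corner_size C e t l J :
  uniq J -> {subset J <= monomials C e} ->
  (forall m, m \in J -> t <= m (lshift n l)) ->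
  2 * size J <= size C * ((e.+1 - t) * (e.+2 - t)).
Proof.
move=> uJ Je Jt.
have [te|et] := leqP t e; last first.
  case: J uJ Je Jt => [|m J] _ Je Jt; first by rewrite muln0.
  have mJ : m \in m :: J by rewrite inE eqxx.
  have := Je m mJ; rewrite mem_monomials => /andP[/eqP me _].
  by have := leq_trans (Jt m mJ) (mnm_left_le m l); rewrite me leqNgt et.
have -> : (e.+1 - t) * (e.+2 - t) = (e - t).+1 * (e - t).+2 by congr (_ * _); lia.
rewrite -size_monomials leq_mul2l /=.
rewrite -(size_map (fun m => (m - U l *+ t)%MM)); apply: uniq_leq_size.
  rewrite map_inj_in_uniq // => m m' mJ mJ' E.
  have lem k : k \in J -> (U l *+ t <= k)%MM.
    move=> kJ; apply/mnm_lepP => i; rewrite mulmnE mnm1E.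
    by case: eqP => [<-|_]; rewrite ?mul1n ?mul0n // Jt.
  by rewrite -(submK (lem m mJ)) E submK ?lem.
move=> _ /mapP[m mJ ->]; move: (Je m mJ); rewrite !mem_monomials.
move=> /andP[/eqP <- mC]; apply/andP; split; last first.
  rewrite (_ : mnm_right _ = mnm_right m) //; apply/mnmP => i.
  by rewrite !mnmE mulmnE mnm1E eq_lrshift mul0n subn0.
apply/eqP; rewrite !mdegE (bigD1 l) //= [in RHS](bigD1 l) //= !mnmE mulmnE mnm1E eqxx mul1n.
rewrite (eq_bigr (mnm_left m)) => [|i il]; last first.
  by rewrite !mnmE mulmnE mnm1E eq_lshift eq_sym (negPf il) mul0n subn0.
have := Jt m mJ; lia.
Qed.

(** Growth by the factor [(s + 2) / s] is at least growth by [(q + 2) / q] on the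
    smaller corners, those with [s <= q]. *)
Lemma flat_growth s q x y : 0 < s -> s <= q -> (s + 2) * x <= s * y -> (q + 2) * x <= q * y.
Proof.
move=> s0 sq sxy; have xy : x <= y by rewrite -(leq_pmul2l s0); nia.
by rewrite -(subnKC sq) -(subnKC xy) in sxy *; nia.
Qed.

(** On the larger corner the growth factor is smaller than [(q + 2) / q]; the loss
    is made up by the bound on the size of the corner. The inequality is affine in
    [q], between the case [q = s], which is the growth, and [q = 0], which is the
    size. *)
Lemma steep_growth s q h x y : q <= s -> 2 * x <= h * (s * s.+1) ->
  (s + 2) * x <= s * y -> (q + 2) * x <= q * y + h * ((s + 1) * (s - q)).
Proof.
move=> qs xh sxy; have [s0|s0] := posnP s.
  by have -> : x = 0; [move: xh; rewrite s0 mul0n muln0; lia|rewrite muln0].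
rewrite -(leq_pmul2l s0).
have sxy' : q * ((s + 2) * x) <= q * (s * y) by rewrite leq_mul2l sxy orbT.
have xh' : (s - q) * (2 * x) <= (s - q) * (h * (s * s.+1)) by rewrite leq_mul2l xh orbT.
have e : s = q + (s - q) by lia.
move: (s - q) e sxy' xh' => t ->; lia.
Qed.

Lemma corner_arith a0 a1 a2 h j j' rho rho' p p' x0 x1 x2 y0 y1 y2 (d := a1 + a2) :
  a2 <= a1 -> a1 <= a0 ->
  2 * p = h * (d.+1 * d.+2) -> 2 * p' = h * (d.+2 * d.+3) ->
  j + rho = p -> j' + rho' = p' -> rho <= rho' ->
  j <= x0 + (x1 + x2) -> y0 + (y1 + y2) <= j' ->
  2 * x0 <= h * ((d - a0) * (d - a0).+1) -> 2 * x2 <= h * ((d - a2) * (d - a2).+1) ->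
  (d + 2 - a0) * x0 <= (d - a0) * y0 ->
  (d + 2 - a1) * x1 <= (d - a1) * y1 ->
  (d + 2 - a2) * x2 <= (d - a2) * y2 ->
  (a1 + 1) * (a2 + 1) * h <= rho.
Proof.
rewrite {}/d -!addnA !addKn [a1 + (a2 + 2)]addnCA addKn [a1 + a2 - a2]addnK.
move=> a12 a01 sz sz' cardJ cardJ' rho_le cover disjoint c0 c2 g0 g1 g2.
have {g0 c0} i0 : (a2 + 2) * x0 <= a2 * y0.
  move: c0 g0 a01; clear => c0 g0 a01.
  have [da|ad] := leqP (a1 + a2) a0.
    have x00 : x0 = 0 by move: c0; rewrite (eqP da) muln0; case: x0 {g0} => // x; rewrite muln0.
    by rewrite x00 muln0.
  apply: (@flat_growth (a1 + a2 - a0)); first by rewrite subn_gt0.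
    by rewrite leq_subLR leq_add2r.
  have e : a1 + a2 - a0 + 2 = a2 + (a1 + 2) - a0 by move: ad; clear; lia.
  by rewrite e.
have {g2 c2} i2 := steep_growth a12 c2 g2.
have {}cover : (a2 + 2) * j <= (a2 + 2) * (x0 + (x1 + x2)).
  by rewrite leq_mul2l cover orbT.
have {}disjoint : a2 * (y0 + (y1 + y2)) <= a2 * j'.
  by rewrite leq_mul2l disjoint orbT.
have le_j' : a2 * j' <= a2 * (j + h * (a1 + a2 + 2)).
  rewrite leq_mul2l; apply/orP; right; move: sz sz' cardJ cardJ' rho_le; clear; lia.
have {le_j' i0 g1 i2 cover disjoint} :
    (a2 + 2) * j <= a2 * (j + h * (a1 + a2 + 2)) + h * ((a1 + 1) * (a1 - a2)).
  by move: le_j' i0 g1 i2 cover disjoint; clear; lia.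
move: sz cardJ a12; clear => sz cardJ a12.
have [t e] : exists t, a1 = a2 + t by exists (a1 - a2); rewrite subnKC.
by subst a1; rewrite addKn; lia.
Qed.

(** Here [J] and [J'] stand for the leading monomials in two successive degrees,
    and [rho], [rho'] for the ranks of evaluation there. *)
Theorem corner_bound C (a0 a1 a2 rho rho' : nat) (J J' : seq 'X_{1..3 + n}) :
  uniq C -> a1 <= a0 -> a2 <= a1 -> uniq J -> uniq J' ->
  {subset J <= monomials C (a1 + a2)} -> {subset J' <= monomials C (a1 + a2).+1} ->
  (forall m, m \in J -> exists l : 'I_3, nth 0 [:: a0; a1; a2] l < m (lshift n l)) ->
  (forall m i, m \in J -> (m + U i)%MM \in J') ->
  size J + rho = size (monomials C (a1 + a2)) ->
  size J' + rho' = size (monomials C (a1 + a2).+1) ->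
  rho <= rho' ->
  (a1 + 1) * (a2 + 1) * size C <= rho.
Proof.
move=> uC a01 a12 uJ uJ' Jd Jd' Jcorner JJ' cardJ cardJ' rho_le.
pose d := a1 + a2; pose a (l : 'I_3) := nth 0 [:: a0; a1; a2] l.
pose A l := [seq m : 'X_{1..3 + n} <- J | a l < m (lshift n l)].
pose A' l := [seq m : 'X_{1..3 + n} <- J' | a l < m (lshift n l)].
have growth l : (d + 2 - a l) * size (A l) <= (d - a l) * size (A' l).
  have := @corner_growth C d (a l).+1 l (A l) (A' l).
  have -> : d + 3 - (a l).+1 = d + 2 - a l by lia.
  have -> : d + 1 - (a l).+1 = d - a l by lia.
  apply; rewrite ?filter_uniq //.
  - by move=> m; rewrite mem_filter => /andP[_ /Jd].
  - by move=> m; rewrite mem_filter => /andP[_ /Jd'].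
  - by move=> m; rewrite mem_filter => /andP[].
  - by move=> m; rewrite mem_filter => /andP[].
  - move=> m i; rewrite !mem_filter => /andP[ma mJ]; rewrite JJ' // andbT mnmDE.
    exact: leq_trans ma (leq_addr _ _).
have cover : size J <= \sum_l size (A l).
  rewrite /A; under eq_bigr do rewrite size_filter -sum1_count big_mkcond /=.
  rewrite exchange_big /= -sum1_size big_seq [X in _ <= X]big_seq.
  apply: leq_sum => m /Jcorner[l ml].
  by rewrite (bigD1 l) //= /a ml leq_addr.
(* Exponents above [a i] and above [a j] need degree at least [a1 + a2 + 2]. *)
have disjoint : \sum_l size (A' l) <= size J'.
  rewrite /A'; under eq_bigr do rewrite size_filter -sum1_count big_mkcond /=.
  rewrite exchange_big /= -sum1_size big_seq [X in _ <= X]big_seq.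
  apply: leq_sum => m /Jd'; rewrite mem_monomials => /andP[/eqP md _].
  move: md; rewrite mdeg3 !mnmE !big_ord_recl big_ord0 /a /=.
  move: (m _) (m _) (m _) => w v u {a A A' growth cover}.
  by case: (ltnP a0 u); case: (ltnP a1 v); case: (ltnP a2 w) => * /=; lia.
have corner l : 2 * size (A l) <= size C * ((d - a l) * (d - a l).+1).
  have := @corner_size C d (a l).+1 l (A l).
  have -> : d.+1 - (a l).+1 = d - a l by lia.
  have [ad|da] := leqP (a l) d; last first.
    have -> : d - a l = 0 by lia.
    by rewrite !muln0; apply; rewrite ?filter_uniq // => m; rewrite mem_filter => /andP[] // _ /Jd.
  have -> : d.+2 - (a l).+1 = (d - a l).+1 by lia.
  by apply; rewrite ?filter_uniq // => m; rewrite mem_filter => /andP[] // _ /Jd.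
have sz := size_monomials C d; have sz' := size_monomials C d.+1.
move: (growth ord0) (growth (lift ord0 ord0)) (growth (lift ord0 (lift ord0 ord0))).
move: (corner ord0) (corner (lift ord0 ord0)) (corner (lift ord0 (lift ord0 ord0))).
move: cover disjoint; rewrite !big_ord_recl !big_ord0 !addn0 /a /=.
move: (size (A _)) (size (A _)) (size (A _)) (size (A' _)) (size (A' _)) (size (A' _)).
move=> x2 x1 x0 y2 y1 y0.
move=> cover disjoint c0 _ c2 g0 g1 g2.
exact: (corner_arith a12 a01 sz sz' cardJ cardJ' rho_le cover disjoint c0 c2 g0 g1 g2).
Qed.

End Monomials.
End Corners.

(** * The bound at a valuation of a secant point *)

Lemma mmap1D n (A : comNzRingType) (h : 'I_n -> A) m1 m2 :
  mmap1 h (m1 + m2) = mmap1 h m1 * mmap1 h m2.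
Proof. by apply: commr_mmap1_M => i x; apply: mulrC. Qed.

Lemma rmorph_mmap1 n (A B : comNzRingType) (phi : {rmorphism A -> B}) (h : 'I_n -> A) m :
  phi (mmap1 h m) = mmap1 (phi \o h) m.
Proof. by rewrite rmorph_prod; apply: eq_bigr => i _; rewrite rmorphXn. Qed.

(** The value on [x^c] of a combination of evaluation functionals, with
    coefficients [l], at the points [p]. *)
Definition secant_coord (A : comNzRingType) N r (l : 'I_r -> A) (p : 'I_r -> 'I_N -> A)
    (c : 'X_{1..N}) : A :=
  \sum_i l i * mmap1 (p i) c.

Lemma rmorph_secant_coord (A B : comNzRingType) (phi : {rmorphism A -> B}) N r l p c :
  phi (@secant_coord A N r l p c) = secant_coord (phi \o l) (fun i => phi \o p i) c.
Proof.
by rewrite rmorph_sum; apply: eq_bigr => i _; rewrite rmorphM rmorph_mmap1.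
Qed.

Section ApolarityBound.
Variables (M : fieldType) (O : set M).
Hypothesis O_val : valuation_subring O.
Variables (n r : nat) (C : seq 'X_{1..n}).
Hypothesis C_uniq : uniq C.
Variables (l : 'I_r -> M) (p : 'I_r -> 'I_(3 + n) -> M).
Hypothesis p0 : forall i, p i (lshift n ord0) != 0.

Local Notation s e := (in_tuple (monomials C e)).
Definition point_matrix e : 'M[M]_(size (monomials C e), r) :=
  \matrix_(k, i) mmap1 (p i) (tnth (s e) k).
Local Notation W := point_matrix.
Local Notation key e := (tnth (s e)).

Lemma key_inj e : injective (key e).
Proof.
have : uniq (s e) by exact: monomials_uniq.
by move/tuple_uniqP.
Qed.

Definition leading_monomials e : seq 'X_{1..3 + n} :=
  [seq key e k | k <- enum (leading_set O (key e) (W e))].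
Local Notation J := leading_monomials.

Lemma leading_monomials_uniq e : uniq (J e).
Proof. by rewrite map_inj_uniq ?enum_uniq //; apply: key_inj. Qed.

Lemma leading_monomials_sub e : {subset J e <= monomials C e}.
Proof. by move=> _ /mapP[k _ ->]; apply: (mem_tnth k (s e)). Qed.

Lemma size_leading_monomials e : (size (J e) + \rank (W e))%N = size (monomials C e).
Proof.
rewrite size_map -cardE; apply: card_leading_set => //; exact: key_inj.
Qed.

Definition addU_index e (i : 'I_3) (k : 'I_(size (monomials C e))) :
    'I_(size (monomials C e.+1)).
Proof.
exists (index (key e k + U_(lshift n i))%MM (monomials C e.+1)).
by rewrite index_mem monomials_addU //; apply: (mem_tnth k (s e)).
Defined.

Lemma key_addU e i k : key e.+1 (@addU_index e i k) = (key e k + U_(lshift n i))%MM.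
Proof.
rewrite (tnth_nth 0%MM) /= nth_index // monomials_addU //.
exact: (mem_tnth k (s e)).
Qed.

Lemma point_matrix_addU e i :
  rowsub (@addU_index e i) (W e.+1) =
  W e *m diag_mx (\row_j p j (lshift n i)).
Proof.
apply/matrixP => k j; rewrite mul_mx_diag !mxE key_addU.
by rewrite mmap1D mmap1U.
Qed.

Lemma leading_monomials_addU e m i :
  m \in J e -> (m + U_(lshift n i))%MM \in J e.+1.
Proof.
case/mapP => k; rewrite mem_enum => kJ ->; apply/mapP.
exists (addU_index i k); last by rewrite key_addU.
rewrite mem_enum; move: k kJ.
apply: (leading_set_shift O_val (@key_inj e) _ (point_matrix_addU e i)) => k k'.
by rewrite !key_addU ltmc_add2l.
Qed.

(** Multiplication by the first variable, which vanishes at none of the points, is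
    injective on forms modulo those that vanish at the points. *)
Lemma rank_point_matrix e : (\rank (W e) <= \rank (W e.+1))%N.
Proof.
pose D := diag_mx (\row_j p j (lshift n ord0)).
have D_free : row_free D.
  rewrite row_free_unit unitmxE det_diag unitfE; apply/prodf_neq0 => j _.
  by rewrite mxE.
by rewrite -(mxrankMfree _ D_free) -point_matrix_addU mxrankS // rowsub_sub.
Qed.

(* The secant point specializes to the monomial [x^c0]. *)
Variable c0 : 'X_{1..3 + n}.
Hypothesis c0_neq0 : secant_coord l p c0 != 0.
Hypothesis c0_leading : forall e m m' g,
  m \in monomials C e -> m' \in monomials C e -> (g + m)%MM = c0 -> m' != m ->
  max_ideal O (secant_coord l p (g + m')%MM / secant_coord l p c0).

(** Let [f] be a form vanishing at the points, with leading monomial [x^m], and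
    suppose that [x^g x^m = x^c0]. The secant point kills [x^g f], and after
    division by the leading coefficient and by its own coordinate at [c0] this
    reads [1 + z = 0], where all terms of [z] lie in the maximal ideal. *)
Lemma leading_monomials_Ann e m : m \in J e -> ~~ (m <= c0)%MM.
Proof.
case/mapP => k; rewrite mem_enum => /leading_setP[f [fW [fk lead_k]]] ->.
apply/negP => mc; pose g := (c0 - key e k)%MM.
have gk : (g + key e k)%MM = c0 by rewrite submK.
have : \sum_k' f 0 k' * secant_coord l p (g + key e k')%MM = 0.
  rewrite /secant_coord; under eq_bigr do rewrite mulr_sumr.
  rewrite exchange_big big1 // => i _.
  have : (f *m W e) 0 i = 0 by rewrite fW mxE.
  rewrite mxE => fWi; rewrite -[RHS](mulr0 (l i * mmap1 (p i) g)) -[in RHS]fWi mulr_sumr.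
  by apply: eq_bigr => k' _; rewrite mxE mmap1D mulrCA -[RHS]mulrA; congr (_ * _); rewrite mulrCA.
rewrite (bigD1 k) //= gk; move/eqP; rewrite addr_eq0 => /eqP e0.
apply: (max_ideal_not1 O_val).
have nz : f 0 k * secant_coord l p c0 != 0 by rewrite mulf_neq0.
rewrite -(divff nz) {1}e0 mulNr; apply: max_idealN => //; rewrite mulr_suml.
apply: max_ideal_sum => // k' kk'; rewrite invfM mulrACA.
apply: max_idealMl => //; first by case: (lead_k k').
apply: (c0_leading (e := e) _ _ gk); try exact: (mem_tnth _ (s e)).
by rewrite (inj_eq (@key_inj e)).
Qed.

Theorem apolarity_bound a0 a1 a2 : (a1 <= a0)%N -> (a2 <= a1)%N ->
  (forall i, c0 (lshift n i) = nth 0%N [:: a0; a1; a2] i) ->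
  (forall c, c \in C -> (c <= mnm_right c0)%MM) ->
  ((a1 + 1) * (a2 + 1) * size C <= r)%N.
Proof.
move=> a01 a12 c0l c0r; apply: leq_trans (rank_leq_col (W (a1 + a2)%N)).
apply: (corner_bound C_uniq a01 a12 (leading_monomials_uniq _) (leading_monomials_uniq _)
  (@leading_monomials_sub _) (@leading_monomials_sub _) _ _
  (size_leading_monomials _) (size_leading_monomials _) (rank_point_matrix _)); last first.
  by move=> m i; apply: leading_monomials_addU.
move=> m mJ; apply: contrapT => no; have := leading_monomials_Ann mJ.
move/negP; apply; apply/mnm_lepP => i; rewrite -(splitK i); case: (split i) => j /=.
  by rewrite c0l leqNgt; apply/negP => lt; apply: no; exists j.
have := leading_monomials_sub mJ; rewrite mem_monomials => /andP[_ /c0r /mnm_lepP/(_ j)].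
by rewrite !mnmE.
Qed.
End ApolarityBound.

(** * Valuations at points of the closure of a secant variety *)

Section GenericSecant.
Variables (K : fieldType) (N r : nat).
Local Notation P := {mpoly K[r * N.+1]}.

(** The variables are the entries of an [r x (N + 1)] matrix: the coefficients in
    column [0], the coordinates of the points in the others. *)
Definition generic_coef (i : 'I_r) : P := 'X_(mxvec_index i ord0).
Definition generic_point (i : 'I_r) (j : 'I_N) : P := 'X_(mxvec_index i (lift ord0 j)).
Local Notation gcoord := (secant_coord generic_coef generic_point).

Lemma generic_specialize (l : 'I_r -> K) (p : 'I_r -> 'I_N -> K) :
  exists v, forall c, (gcoord c).@[v] = secant_coord l p c.
Proof.
pose A : 'M[K]_(r, N.+1) :=
  \matrix_(i, j) (if unlift ord0 j is Some k then p i k else l i).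
exists (mxvec A 0) => c; rewrite (rmorph_secant_coord (meval (mxvec A 0))).
apply: eq_bigr => i _; congr (_ * _).
  by rewrite /= mevalXU mxvecE mxE unlift_none.
by apply: mmap1_eq => j; rewrite /= mevalXU mxvecE mxE liftK.
Qed.

(* In the coordinates indexed by [cs], the point [pt] of the dual space is the
   multiple [a] of the [i0]-th coordinate vector. *)
Variables (k : nat) (cs : 'I_k -> 'X_{1..N}) (i0 : 'I_k) (a : K).
Hypothesis a_neq0 : a != 0.
Local Notation pt := (fun i => a * (i == i0)%:R).
Hypothesis closure : forall e (Q : {mpoly K[k]}), Q \is e.-homog ->
  (forall l p, Q.@[fun i => secant_coord (r := r) l p (cs i)] = 0) -> Q.@[pt] = 0.

Local Notation lq := [tuple gcoord (cs i) | i < k].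

Lemma generic_closure e (Q : {mpoly K[k]}) :
  Q \is e.-homog -> Q \mPo lq = 0 -> Q.@[pt] = 0.
Proof.
move=> Qe Q0; apply: (closure Qe) => l p.
have [v vE] := generic_specialize l p.
transitivity ((Q \mPo lq).@[v]); last by rewrite Q0 meval0.
by rewrite comp_mpoly_meval; apply: meval_eq => i; rewrite tnth_mktuple vE.
Qed.

Local Notation M := {fraction P}.
Local Notation u0 := (gcoord (cs i0)).

Let X0e e : ('X_i0 : {mpoly K[k]}) ^+ e \is e.-homog.
Proof. by rewrite -{2}[e]mul1n; apply: dhomogMn; rewrite dhomogX; apply/eqP/mdeg1. Qed.

Lemma generic_u0_neq0 : u0 != 0.
Proof.
apply/eqP => u00; have := @generic_closure 1 'X_i0 (X0e 1).
rewrite comp_mpolyXU -tnth_nth tnth_mktuple => /(_ u00)/eqP.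
by rewrite mevalXU eqxx mulr1 (negPf a_neq0).
Qed.

Local Open Scope classical_set_scope.
(** The rational functions on the secant variety of the form [Q / X_i0 ^ e], with
    [Q] a form of degree [e], that vanish at the point [pt]. *)
Definition degenerate_ratios : set M :=
  [set x | exists e (Q : {mpoly K[k]}),
    [/\ Q \is e.-homog, Q.@[pt] = 0 & x * (tofrac u0) ^+ e = tofrac (Q \mPo lq)]].

Let X0_lq e : ('X_i0 ^+ e) \mPo lq = u0 ^+ e.
Proof. by rewrite rmorphXn /= comp_mpolyXU -tnth_nth tnth_mktuple. Qed.

Lemma degenerate_ratios_ring : nonunital_subring degenerate_ratios.
Proof.
split.
- exists 0%N, 0; rewrite meval0 comp_mpoly0 rmorph0 mul0r; split=> //.
  exact: dhomog0.
- move=> x y [e [Q [Qe Q0 Ex]]] [e' [Q' [Qe' Q0' Ey]]].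
  exists (e + e')%N, (Q * 'X_i0 ^+ e' - Q' * 'X_i0 ^+ e); split.
  + apply: rpredB; first exact: dhomogM.
    by rewrite addnC; apply: dhomogM.
  + by rewrite mevalB !mevalM Q0 Q0' !mul0r subrr.
  rewrite comp_mpolyB rmorphB /= !rmorphM /= !X0_lq !rmorphXn /= -Ex -Ey.
  by rewrite mulrBl exprD mulrA [_ ^+ e * _]mulrC mulrA.
move=> x y [e [Q [Qe Q0 Ex]]] [e' [Q' [Qe' Q0' Ey]]].
exists (e + e')%N, (Q * Q'); split; first exact: dhomogM.
  by rewrite mevalM Q0 mul0r.
by rewrite !rmorphM /= -Ex -Ey exprD mulrACA.
Qed.

(** If [Q = X_i0 ^ e] on the secant variety, then the same holds on its closure, but
    at [pt] the two sides are [0] and [a ^ e]. *)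
Lemma degenerate_ratios_not1 : ~ degenerate_ratios 1.
Proof.
move=> [e [Q [Qe Q0]]]; rewrite mul1r -rmorphXn /= => /eqP; rewrite tofrac_eq => /eqP E.
have : (Q - 'X_i0 ^+ e).@[pt] = 0.
  apply: (@generic_closure e); first by apply: rpredB; [|apply: X0e].
  by rewrite comp_mpolyB X0_lq -E subrr.
rewrite mevalB Q0 sub0r rmorphXn /= mevalXU eqxx mulr1 => /eqP.
by rewrite oppr_eq0 expf_eq0 (negPf a_neq0) andbF.
Qed.

(** Chevalley's theorem applied to [degenerate_ratios], whose elements all have to
    specialize to [0]. *)
Theorem secant_closure_valuation :
  exists (M : fieldType) (O : set M) (l : 'I_r -> M) (p : 'I_r -> 'I_N -> M),
  [/\ valuation_subring O, forall i j, p i j != 0,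
      secant_coord l p (cs i0) != 0
    & forall i, i != i0 ->
        max_ideal O (secant_coord l p (cs i) / secant_coord l p (cs i0))].
Proof.
have [O [O_val sub_O]] := chevalley degenerate_ratios_ring degenerate_ratios_not1.
exists M, O, (fun i => tofrac (generic_coef i)), (fun i j => tofrac (generic_point i j)).
have tofracE c : secant_coord (fun i => tofrac (generic_coef i))
    (fun i j => tofrac (generic_point i j)) c = tofrac (gcoord c) :> M.
  by rewrite rmorph_secant_coord.
split=> // [i j||i ii0]; rewrite ?tofracE.
- by rewrite tofrac_eq0 -msupp_eq0 msuppX.
- by rewrite tofrac_eq0 generic_u0_neq0.
apply: sub_O; exists 1%N, 'X_i; split.
- by rewrite dhomogX; apply/eqP/mdeg1.
- by rewrite mevalXU (negPf ii0) mulr0.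
rewrite expr1 divfK ?tofrac_eq0 ?generic_u0_neq0 //.
by rewrite comp_mpolyXU -tnth_nth tnth_mktuple.
Qed.
End GenericSecant.

(** * The graded pieces of the Cox ring and of its dual *)

Section Digits.
Local Open Scope nat_scope.
Lemma digits_inj N B (c c' : 'I_N -> nat) :
  (forall i, c i < B) -> (forall i, c' i < B) ->
  \sum_i c i * B ^ i = \sum_i c' i * B ^ i -> c =1 c'.
Proof.
elim: N c c' => [|N IH] c c' cB c'B; first by move=> _ [].
have E f : \sum_(i < N.+1) f i * B ^ i =
    (\sum_(i < N) f (lift ord0 i) * B ^ i) * B + f ord0.
  rewrite big_ord_recl expn0 muln1 addnC; congr (_ + _).
  by rewrite big_distrl; apply: eq_bigr => i _; rewrite lift0 expnSr mulnA.
rewrite !E => e; have B0 : 0 < B by apply: leq_ltn_trans (cB ord0).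
have e0 : c ord0 = c' ord0.
  by move/(congr1 (modn^~ B)): e; rewrite !modnMDl !modn_small.
move: e; rewrite e0 => /addIn/eqP; rewrite eqn_pmul2r // => /eqP/IH e i.
case: (unliftP ord0 i) => [j ->|->] //; exact: e.
Qed.
End Digits.

Section Pairing.
Variables (K : fieldType) (N : nat).
Implicit Types (H T : {mpoly K[N]}).

Lemma contractX c H : contract 'X_[c] H = H^`M[c].
Proof. by rewrite /contract msuppX big_seq1 mcoeffX eqxx scale1r. Qed.

Lemma pairingX c H : pairing 'X_[c] H = H@_c *+ \prod_i (c i)`!.
Proof.
rewrite /pairing contractX mcoeff_mderivm addm0; congr (_ *+ _).
by apply: eq_bigr => i _; rewrite ffactnn.
Qed.

Lemma pairing_sum T r (l : 'I_r -> K) (v : 'I_r -> {mpoly K[N]}) :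
  pairing T (\sum_i l i *: v i) = \sum_i l i * pairing T (v i).
Proof.
rewrite /pairing /contract !raddf_sum /=.
under [RHS]eq_bigr do rewrite raddf_sum mulr_sumr.
rewrite exchange_big; apply: eq_bigr => a _.
rewrite mcoeffZ raddf_sum raddf_sum mulr_sumr; apply: eq_bigr => i _ /=.
by rewrite mderivmZ !mcoeffZ mulrCA.
Qed.
End Pairing.

Section Toric.
Variables (R : realType) (Y : fan).
Local Notation K := (complex R).
Implicit Types (L D : divisor Y).

Lemma natC_neq0 n : (0 < n)%N -> n%:R != 0 :> K.
Proof. by rewrite pnatr_eq0 lt0n. Qed.

Lemma prod_fact_gt0 N (c : 'X_{1..N}) : (0 < \prod_i (c i)`!)%N.
Proof. by apply/prodn_gt0 => i; apply: fact_gt0. Qed.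

Lemma graded_X L c : lin_equiv (mon_degree c) L -> graded L ('X_[c] : cox R Y).
Proof. by move=> cL c'; rewrite msuppX inE => /eqP ->. Qed.

Lemma mevalX_mmap1 (p : 'I_(nrays Y) -> K) c : ('X_[c] : cox R Y).@[p] = mmap1 p c.
Proof. by rewrite mevalX. Qed.

(** The evaluation functional at a point of the torus is a polynomial in which
    every monomial of degree [L] occurs; so there are finitely many of these. *)
Lemma finite_monomials L p (v : dual_cox R Y) :
  (forall i, p i != 0) -> lin_system L p v ->
  exists s : seq 'X_{1..nrays Y}, uniq s /\
    forall c, (c \in s) <-> lin_equiv (mon_degree c) L.
Proof.
move=> p0 [_ [l l0 ev]].
exists [seq c <- msupp v | `[< lin_equiv (mon_degree c) L >]].
split; first by rewrite filter_uniq // msupp_uniq.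
move=> c; rewrite mem_filter; split=> [/andP[/asboolP]//|cL].
apply/andP; split; first exact/asboolP.
rewrite mcoeff_msupp; apply/eqP => vc0.
have /eqP := ev _ (graded_X cL); rewrite pairingX vc0 mul0rn eq_sym mulf_eq0.
rewrite (negPf l0) mevalX_mmap1 /=; apply/negP/prodf_neq0 => i _.
by rewrite expf_neq0.
Qed.

(** In the coordinates given by the monomials of degree [L], a point of the span of
    [r] points of the variety is a secant point of affine space; the scalars
    relating the [v i] to the evaluations are absorbed by [l]. *)
Lemma spans_coord L r (V : dual_cox R Y) : spans L r V ->
  exists l p, forall c, lin_equiv (mon_degree c) L ->
    pairing 'X_[c] V = @secant_coord K _ r l p c.
Proof.
move=> [_ [p [v [l [_ vp ->]]]]].
have /choice[la laP] i : exists a : K, forall T : cox R Y, graded L T ->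
    pairing T (v i) = a * T.@[p i].
  by have [_ [a _ ev]] := vp i; exists a.
exists (fun i => l i * la i), p => c cL; rewrite pairing_sum.
apply: eq_bigr => i _; rewrite (laP i _ (graded_X cL)) mevalX_mmap1.
by rewrite mulrA.
Qed.

Lemma subspace_dim_le D (C : seq 'X_{1..nrays Y}) :
  (forall c, lin_equiv (mon_degree c) D -> c \in C) ->
  (subspace_dim (graded (R := R) D) <= size C)%N.
Proof.
move=> CD; rewrite /subspace_dim; case: xgetP => // d _ [e [eD e_free _]].
pose A : 'M[K]_(d, size C) := \matrix_(i, j) (e i)@_(tnth (in_tuple C) j).
suff : row_free A by move=> /eqP <-; apply: rank_leq_col.
apply: inj_row_free => v vA; apply/rowP => i; rewrite mxE.
apply: (e_free (v 0)); apply/mpolyP => c; rewrite mcoeff0 raddf_sum /=.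
under eq_bigr do rewrite mcoeffZ.
have [cC|cC] := boolP (c \in C); last first.
  rewrite big1 // => j _; rewrite memN_msupp_eq0 ?mulr0 //.
  by apply: contra cC => /eD /CD.
have [j ->] : exists j, c = tnth (in_tuple C) j by apply/tnthP.
have : (v *m A) 0 j = 0 by rewrite vA mxE.
by rewrite mxE => E; rewrite -[RHS]E; apply: eq_bigr => k _; rewrite mxE.
Qed.

(** A monomial that does not divide [x^b] annihilates it. *)
Lemma Ann_monomials D b :
  (forall T : cox R Y, graded D T -> Ann (divmon b : dual_cox R Y) T -> T = 0) ->
  exists C : seq 'X_{1..nrays Y}, [/\ uniq C,
    forall c, c \in C -> lin_equiv (mon_degree c) D,
    forall c, c \in C -> (c <= b)%MM
    & forall c, lin_equiv (mon_degree c) D -> c \in C].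
Proof.
move=> hD.
have le_b c : lin_equiv (mon_degree c) D -> (c <= b)%MM.
  move=> cD; apply: contraT => cb.
  suff /hD -/(_ (graded_X cD))/eqP : Ann (divmon b : dual_cox R Y) 'X_[c].
    by rewrite -msupp_eq0 msuppX.
  rewrite /Ann /= contractX; apply/mpolyP => m; rewrite mcoeff0 mcoeff_mderivm.
  rewrite mcoeffZ mcoeffX; case: eqP => [E|]; last by rewrite mulr0 mul0rn.
  by rewrite E lem_addr in cb.
pose S := [seq bmnm c | c : bmultinom (nrays Y) (mdeg b).+1].
exists [seq c <- S | `[< lin_equiv (mon_degree c) D >]]; split.
- by rewrite filter_uniq // map_inj_uniq ?enum_uniq //; apply: val_inj.
- by move=> c; rewrite mem_filter => /andP[/asboolP].
- by move=> c; rewrite mem_filter => /andP[/asboolP/le_b].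
move=> c cD; rewrite mem_filter; apply/andP; split; first exact/asboolP.
have cb : (mdeg c < (mdeg b).+1)%N.
  by rewrite ltnS !mdegE leq_sum // => i _; have /mnm_lepP := le_b c cD.
by apply/mapP; exists (BMultinom cb); rewrite ?mem_enum.
Qed.

End Toric.

(** * Torus points span the dual of the space of sections *)

Section Spanning.
Variables (R : realType) (Y : fan).
Local Notation K := (complex R).
Implicit Types (L : divisor Y).

Lemma mmap1_expn N (p : 'I_N -> K) k (c : 'X_{1..N}) :
  mmap1 (fun i => p i ^+ k) c = mmap1 p c ^+ k.
Proof.
rewrite /mmap1 -prodrXl; apply: eq_bigr => i _.
by rewrite -!exprM mulnC.
Qed.

(** At [p i = 2 ^ (B ^ i)] a monomial takes the value [2 ^ n], where the digits of
    [n] in base [B] are the exponents. *)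
Lemma separating_point N (s : seq 'X_{1..N}) :
  exists p : 'I_N -> K, (forall i, p i != 0) /\ {in s &, injective (mmap1 p)}.
Proof.
pose B := (\max_(c <- s) mdeg c).+1.
have ltB c i : c \in s -> (c i < B)%N.
  move=> cs; rewrite ltnS; apply: (@leq_trans (mdeg c)).
    by rewrite mdegE (bigD1 i) //= leq_addr.
  by rewrite (big_rem c) //= leq_maxl.
exists (fun i => 2%:R ^+ (B ^ i)); split=> [i|c c' cs cs'].
  by rewrite expf_neq0 // pnatr_eq0.
have E c1 : mmap1 (fun i : 'I_N => 2%:R ^+ (B ^ i)%N) c1 =
    2%:R ^+ (\sum_i c1 i * B ^ i)%N :> K.
  by rewrite -prodrXr; apply: eq_bigr => i _; rewrite -exprM mulnC.
rewrite !E -!natrX => /eqP; rewrite eqr_nat => /eqP/expnI-/(_ isT) e.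
by apply/mnmP; apply: (digits_inj _ _ e) => i; apply: ltB.
Qed.

Lemma torus_is_point (p : 'I_(nrays Y) -> K) :
  finset.set0 \in cones Y -> (forall i, p i != 0) -> is_point p.
Proof. by move=> Y0 p0; exists finset.set0. Qed.

(** Take the powers [p ^ k] of a point [p] of the torus that separates the monomials
    of degree [L]. Combining the evaluations at them with the coefficients of a
    polynomial [q] gives the functional whose value on [x^c] is [q(x^c(p))], so a
    Lagrange polynomial yields the functional supported at [c0]. *)
Lemma graded_mnm_spans L (c0 : 'X_{1..nrays Y}) (a : K) :
  very_ample R L -> finset.set0 \in cones Y ->
  a != 0 -> graded L (a *: 'X_[c0] : dual_cox R Y) ->
  exists r, spans L r (a *: 'X_[c0] : dual_cox R Y).
Proof.
move=> [def_L _ _ _] Y0 a0 gH.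
have pt p : (forall i, p i != 0) -> exists v, @lin_system R Y L p v.
  by move=> p0; apply/def_L/torus_is_point.
have [v1 v1P] := pt (fun=> 1) (fun=> oner_neq0 _).
have [s [s_uniq sP]] := finite_monomials (fun=> oner_neq0 _) v1P.
have H0 : a *: 'X_[c0] != 0 :> {mpoly K[nrays Y]}.
  by rewrite scaler_eq0 negb_or a0 -msupp_eq0 msuppX.
have c0s : c0 \in s.
  by apply/sP/gH; rewrite mcoeff_msupp mcoeffZ mcoeffX eqxx mulr1.
have [p [p0 p_inj]] := separating_point s.
pose q := \prod_(c <- rem c0 s) ('X - (mmap1 p c)%:P).
have qs c : c \in s -> c != c0 -> q.[mmap1 p c] = 0.
  move=> cs cc0; rewrite horner_prod (big_rem c) /=; last by rewrite mem_rem_uniq // inE cc0.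
  by rewrite !hornerE subrr mul0r.
have q0 : q.[mmap1 p c0] != 0.
  rewrite horner_prod prodf_seq_neq0; apply/allP => c /=.
  rewrite mem_rem_uniq // !inE => /andP[cc0 cs]; rewrite !hornerE subr_eq0.
  by apply: contra cc0 => /eqP/p_inj ->.
have /choice[v vP] k : exists v, @lin_system R Y L (fun i => p i ^+ k) v.
  by apply: pt => i; rewrite expf_neq0.
have /choice[la laP] k : exists l : K, l != 0 /\ forall T : cox R Y,
    graded L T -> pairing T (v k) = l * T.@[fun i => p i ^+ k].
  by have [_ [l l0 ev]] := vP k; exists l.
pose b := a * (\prod_i (c0 i)`!)%:R / q.[mmap1 p c0].
exists (size q); split; first by split.
exists (fun k i => p i ^+ k), (fun k => v k), (fun k => b * q`_k / la k); split.
- by move=> k; apply: torus_is_point => // i; rewrite expf_neq0.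
- by move=> k; apply: vP.
apply/mpolyP => c; have [cL|cL] := pselect (lin_equiv (mon_degree c) L); last first.
  rewrite memN_msupp_eq0; last by apply/negP => /gH.
  rewrite raddf_sum big1 // => k _ /=; rewrite mcoeffZ memN_msupp_eq0 ?mulr0 //.
  by apply/negP => /((vP k).1.1 c).
have fact0 : (\prod_i (c i)`!)%:R != 0 :> K by rewrite natC_neq0 ?prod_fact_gt0.
apply: (mulIf fact0); rewrite !mulr_natr -!pairingX pairing_sum.
rewrite (eq_bigr (fun k : 'I_(size q) => b * (q`_k * mmap1 p c ^+ k))) => [|k _]; last first.
  have [la0 ev] := laP k.
  rewrite ev; last exact: graded_X.
  by rewrite mulrA divfK // mevalX_mmap1 mmap1_expn mulrA.
rewrite -mulr_sumr -horner_coef pairingX mcoeffZ mcoeffX.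
have [e|cc0] := eqVneq c0 c; last by rewrite mulr0 mul0rn qs ?mulr0 //; [apply/sP|rewrite eq_sym].
by rewrite -e /b divfK // mulr1 mulr_natr.
Qed.
End Spanning.


(** * Degrees on the product *)

Section Product.
Variables (R : realType) (Y : fan).
Local Notation K := (complex R).
Local Notation X := (fan_prod fan_P2 Y).

Lemma set0_cone : is_fan R Y -> complete_fan R Y ->
  finset.set0 \in cones X.
Proof.
move=> [_ faces _] /(_ 0)[s sY _].
rewrite inE; apply/andP; split.
  by rewrite inE; apply/eqP => /setP/(_ ord0); rewrite !inE.
rewrite (_ : _ @^-1: _ = finset.set0)%SET; last by apply/setP => i; rewrite !inE.
by apply: faces sY _; rewrite finset.sub0set.
Qed.

Lemma box_prod_divmon a b :
  exists2 k : K, k != 0 &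
    box_prod (divmon a : dual_cox R fan_P2) (divmon b : dual_cox R Y) =
    k *: 'X_[@mnm_join (nrays Y) a b].
Proof.
exists ((\prod_i (a i)`!)%:R^-1 * (\prod_i (b i)`!)%:R^-1).
  by rewrite mulf_neq0 ?invr_neq0 ?natC_neq0 ?prod_fact_gt0.
rewrite /box_prod /divmon !comp_mpolyZ -scalerAl -scalerAr scalerA; congr (_ *: _).
rewrite !comp_mpolyX mpolyXE_id big_split_ord /=.
by congr (_ * _); apply: eq_bigr => i _; rewrite tnth_mktuple ?mnm_join_l ?mnm_join_r.
Qed.

(** The witness is the character that records the changes of the last two
    exponents; the first exponent then follows from the equality of degrees. *)
Lemma lin_equiv_P2 (t t' : 'X_{1..3}) :
  mdeg t = mdeg t' -> lin_equiv (@mon_degree fan_P2 t') (@mon_degree fan_P2 t).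
Proof.
rewrite !mdeg3 => td.
exists (\col_j ((t' (lift ord0 j))%:Z - (t (lift ord0 j))%:Z)).
apply/colP => i; rewrite !mxE !big_ord_recl big_ord0 !mxE /= addr0.
case: i => [[|[|[|i]]] // lt3] /=.
- rewrite (_ : Ordinal lt3 = ord0); last exact: val_inj.
  by move: td; lia.
- rewrite (_ : Ordinal lt3 = lift ord0 ord0); last exact: val_inj.
  by rewrite mul1r mul0r addr0.
- rewrite (_ : Ordinal lt3 = lift ord0 (lift ord0 ord0)); last exact: val_inj.
  by rewrite mul1r mul0r add0r.
Qed.

Lemma lin_equiv_monomials (D : divisor Y) (C : seq 'X_{1..nrays Y}) e m m' :
  (forall c, c \in C -> lin_equiv (mon_degree c) D) ->
  m \in monomials C e -> m' \in monomials C e ->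
  lin_equiv (@mon_degree X m') (@mon_degree X m).
Proof.
move=> CD; rewrite !mem_monomials => /andP[/eqP me /CD[w wE]] /andP[/eqP me' /CD[w' wE']].
have [x xE] : lin_equiv (@mon_degree fan_P2 (mnm_left m')) (@mon_degree fan_P2 (mnm_left m)).
  by apply: lin_equiv_P2; rewrite me me'.
exists (col_mx x (w' - w)).
rewrite mul_block_col !mul0mx addr0 add0r mulmxBr -wE -wE' -xE opprB addrA subrK.
apply/colP => i; rewrite -(splitK i); case: (split i) => j /=.
  by rewrite col_mxEu !mxE !mnmE.
by rewrite col_mxEd !mxE !mnmE.
Qed.

Lemma lin_equiv_addm (g m m' : 'X_{1..nrays Y}) (L : divisor Y) :
  lin_equiv (mon_degree m') (mon_degree m) -> lin_equiv (mon_degree (g + m)) L ->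
  lin_equiv (mon_degree (g + m')) L.
Proof.
move=> [w wE] [z zE]; exists (w + z); rewrite mulmxDr -wE -zE.
by apply/colP => i; rewrite !mxE !mnmDE !PoszD; lia.
Qed.

End Product.

(** * Border rank of monomials on the product of the plane with a toric variety *)

(** The list [s] enumerates the monomials of degree [L]; they are the coordinates
    in which the closure is turned into a valuation. *)
Lemma closure_secant_bound (R : realType) (Y : fan) (L : divisor (fan_prod fan_P2 Y))
    (D : divisor Y) (C : seq 'X_{1..nrays Y}) (a0 a1 a2 r : nat)
    (c0 : 'X_{1..nrays (fan_prod fan_P2 Y)}) (s : seq 'X_{1..nrays (fan_prod fan_P2 Y)})
    (k : complex R) :
  (a1 <= a0)%N -> (a2 <= a1)%N -> uniq C ->
  (forall c, c \in C -> lin_equiv (mon_degree c) D) ->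
  (forall c, c \in C -> (c <= mnm_right c0)%MM) ->
  (forall i, c0 (lshift (nrays Y) i) = nth 0%N [:: a0; a1; a2] i) ->
  uniq s -> (forall c, (c \in s) <-> lin_equiv (mon_degree c) L) -> c0 \in s ->
  k != 0 ->
  zariski_closure L (spans L r) (k *: 'X_[c0] : dual_cox R (fan_prod fan_P2 Y)) ->
  ((a1 + 1) * (a2 + 1) * size C <= r)%N.
Proof.
move=> a01 a12 uC CD Cb c0l us sL c0s k0 [_ closure].
have [i0 c0E] : exists i0, c0 = tnth (in_tuple s) i0 by apply/tnthP.
have cs_inj : injective (tnth (in_tuple s)) by apply/tuple_uniqP.
pose a : complex R := k * (\prod_i (c0 i)`!)%:R.
have a_neq0 : a != 0 by rewrite mulf_neq0 // natC_neq0 ?prod_fact_gt0.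
have cs_L i : lin_equiv (mon_degree (tnth (in_tuple s) i)) L by apply/sL/mem_tnth.
have [e Q Qe Q0|M [O [l [p [O_val p0 u0 uO]]]]] :=
  @secant_closure_valuation (complex R) _ r _ (tnth (in_tuple s)) i0 a a_neq0.
  have := closure _ (fun i => 'X_[tnth (in_tuple s) i]) Q e.
  have -> : form_at (fun i => 'X_[tnth (in_tuple s) i]) Q (k *: 'X_[c0]) =
      Q.@[fun i => a * (i == i0)%:R].
    apply: meval_eq => i; rewrite pairingX mcoeffZ mcoeffX c0E (inj_eq cs_inj) eq_sym.
    have [->|_] := eqVneq i i0; last by rewrite !mulr0 mul0rn.
    by rewrite /a c0E !mulr1 mulr_natr.
  apply=> // [i|W /spans_coord[l [p Wp]]]; first exact: graded_X.
  by rewrite -(Q0 l p); apply: meval_eq => i; apply: Wp.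
apply: (@apolarity_bound M O O_val (nrays Y) r C uC l p _ c0 _ _ a0 a1 a2 a01 a12 c0l Cb).
- by move=> i; apply: p0.
- by rewrite c0E.
move=> e m m' g mP m'P gm m'm.
have : (g + m')%MM \in s.
  apply/sL/(@lin_equiv_addm (fan_prod fan_P2 Y) g m m').
    exact: (lin_equiv_monomials CD mP m'P).
  by rewrite gm; apply/sL.
case/(tnthP (in_tuple s)) => i iE; rewrite c0E iE; apply: uO.
apply: contra m'm => /eqP ii0; rewrite -(eqm_add2l g) gm iE ii0 -c0E; exact: eqxx.
Qed.

Unset Implicit Arguments.
Theorem theorem6p21 (R : realType) (Y : fan)
    (hY : smooth_projective_toric R Y)
    (a0 a1 a2 : nat) (h01 : (a1 <= a0)%N) (h12 : (a2 <= a1)%N)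
    (b : 'X_{1..nrays Y})
    (F : dual_cox R fan_P2) (hF : F = divmon [multinom [tuple a0; a1; a2]])
    (G : dual_cox R Y) (hG : G = divmon b)
    (L : divisor (fan_prod fan_P2 Y)) (hL : graded L (box_prod F G))
    (hLva : very_ample R L)
    (D : divisor Y)
    (hD : forall T : cox R Y, graded D T -> Ann G T -> T = 0) :
  ((a1 + 1) * (a2 + 1) * subspace_dim (graded (R := R) D)
    <= border_rank L (box_prod F G))%N.
Proof.
rewrite {}hG in hL hD *; rewrite {}hF in hL *.
have [C [uC CD Cb DC]] := Ann_monomials hD.
have [k k0 E] := box_prod_divmon R [multinom [tuple a0; a1; a2]] b.
move: hL; rewrite {}E; set c0 := mnm_join _ _ => hL.
have [Y_fan _ Y_complete _] := hY.
have X0 := set0_cone Y_fan Y_complete.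
have [r0 spans_r0] := graded_mnm_spans hLva X0 k0 hL.
have [|v vP] := let: And4 def_L _ _ _ := hLva in def_L (fun=> 1).
  by apply: torus_is_point => // i; apply: oner_neq0.
have [s [us sL]] := finite_monomials (fun=> oner_neq0 _) vP.
have c0s : c0 \in s.
  by apply/sL/hL; rewrite mcoeff_msupp mcoeffZ mcoeffX eqxx mulr1.
have c0l i : c0 (lshift (nrays Y) i) = nth 0%N [:: a0; a1; a2] i.
  by rewrite mnm_join_l mnm_tnth (tnth_nth 0%N).
apply: (@leq_trans ((a1 + 1) * (a2 + 1) * size C)).
  by rewrite leq_mul2l subspace_dim_le ?orbT.
rewrite /border_rank; case: pselect => [ex|[]]; last first.
  by exists r0; apply/asboolP; split=> [|? ? ? ? _ _ vanish]; [case: spans_r0|apply: vanish].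
case: ex_minnP => r /asboolP closure _.
apply: (closure_secant_bound h01 h12 uC CD _ c0l us sL c0s k0 closure).
by move=> c /Cb; rewrite mnm_right_join.
Qed.
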